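(* If $\alpha$ is a composition of $n$ obtained by shuffling a partition and $(1^k)$ for some $k \ge 0$, then $$\mathcal{K}_\alpha = \{\mathsf{w_r}(T) \mid T \in \mathrm{SET}_{\mathbf{sed}}(\alpha)\}.$$
   Context: Let $n$ be a nonnegative integer. A composition $\alpha=(\alpha_1,\dots,\alpha_l)$ of $n$ is a finite sequence of positive integers with sum $n$; $\ell(\alpha)=l$; $\alpha^{\mathrm r}=(\alpha_l,\dots,\alpha_1)$. It is obtained by shuffling a partition $\lambda$ and $(1^k)$ if it is an interleaving of the sequence $\lambda$ (in its weakly decreasing order) with $k$ ones. The composition diagram of $\alpha$ consists of left-justified rows with $\alpha_i$ cells in the $i$th row from the bottom; $(i,j)$ denotes the cell in the $i$th row from the bottom and $j$th column from the left. $\mathrm{SET}(\alpha)$ is the set of fillings of the composition diagram of $\alpha$ with $1,\dots,n$, each once, whose rows increase from left to right and whose columns all increase from bottom to top. A filling $T$ of the composition diagram of $\alpha$ is SE-decreasing if for all $1\le i<j\le\ell(\alpha)$ with $\alpha_i>\alpha_j$, one has $T(i,k+1)<T(j,k)$ for all $1\le k\le\alpha_j$. $\mathrm{SET}_{\mathbf{sed}}(\alpha)$ is the set of SE-decreasing $T\in\mathrm{SET}(\alpha)$. For a filling $T$, $\mathsf{w_r}(T)$ is the word obtained by reading the entries of each row from right to left, starting with the bottommost row and going up; it is regarded as a permutation in one-line notation. Insertion. Permutations are written as words; $w_0\in\mathfrak S_n$ is the longest element, so $\sigma w_0$ is the reversed word. A Young composition tableau is a filling $T$ of a composition diagram with positive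 integers whose rows weakly increase, whose first column strictly increases from bottom to top, and such that for cells $(i,k+1),(j,k)$ with $i<j$, if $T(i,k+1)\ge T(j,k)$ then $(j,k+1)$ is a cell and $T(i,k+1)>T(j,k+1)$. For such $T$ and a positive integer $k$, define $k\to T$: list the cells $(c_1,d_1),(c_2,d_2),\dots$ of $T$ (before insertion) by decreasing column index $d$ and, within a column, decreasing row index $c$. Set $k_0:=k$ and process $i=1,2,\dots$: if $(c_i,d_i+1)$ is not a cell and $T(c_i,d_i)\le k_0$, place $k_0$ in a new cell $(c_i,d_i+1)$ and stop; if $(c_i,d_i+1)$ is a cell and $T(c_i,d_i)\le k_0<T(c_i,d_i+1)$, interchange $k_0$ with the entry in $(c_i,d_i+1)$ and continue; otherwise continue. If no stop occurs, create a new row with a single cell containing $k_0$, positioned so that the first column strictly increases from bottom to top. For $\sigma\in\mathfrak S_n$, $\hat{\mathsf P}(\sigma)$ is obtained from the empty tableau by inserting $\sigma(1),\dots,\sigma(n)$ successively. $\hat{\mathsf Q}(\sigma)$ is built simultaneously from the empty filling: at step $k$, if the new cell of $\hat{\mathsf P}$ lies in column $c=1$, add to $\hat{\mathsf Q}$ a new row with a single cell containing $k$, positioned so that the first column increases from bottom to top; if $c>1$, append $k$ at the end of the topmost row of $\hat{\mathsf Q}$ having exactly $c-1$ cells. $\mathcal T_\alpha$ is the filling of the composition diagram of $\alpha$ with $1,\dots,n$ from left to right in each row, starting with the bottommost row and going up. $\mathcal K_\alpha=\{\sigma\in\mathfrak S_n\mid\mathrm{sh}(\hat{\mathsf P}(\sigma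 w_0))=\alpha\text{ and }\hat{\mathsf Q}(\sigma w_0)=\mathcal T_{\alpha^{\mathrm r}}\}$, where $\mathrm{sh}$ denotes shape. *)

(* Defs.v *)
From mathcomp Require Import all_boot all_fingroup.

Set Implicit Arguments.
Unset Strict Implicit.
Unset Printing Implicit Defensive.

(** Compositions and fillings *)

Definition is_composition (n : nat) (a : seq nat) : bool :=
  all (leq 1) a && (sumn a == n).

Definition is_partition (l : seq nat) : bool :=
  all (leq 1) l && sorted geq l.

(* The mask [m] marks the positions of [u] that come from [s]. *)
Definition interleaving (s t u : seq nat) : Prop :=
  exists m : bitseq,
    [/\ size m = size u, mask m u = s & mask (map negb m) u = t].

Definition shuffle_of_partition_and_ones (a : seq nat) : Prop :=
  exists (l : seq nat) (k : nat),
    is_partition l /\ interleaving l (nseq k 1) a.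

(* A filling of the diagram of [a] is the sequence of its rows, from the bottom
   row to the top row, each read from left to right; its [shape] is [a].
   Row and column indices start at 0. *)
Definition filling := seq (seq nat).

Definition frow (T : filling) (i : nat) : seq nat := nth [::] T i.

Definition entry (T : filling) (i j : nat) : nat := nth 0 (frow T i) j.

Definition is_cell (T : filling) (i j : nat) : bool := j < size (frow T i).

Definition columns_increase (T : filling) : Prop :=
  forall i i' j : nat, i < i' -> is_cell T i j -> is_cell T i' j ->
    entry T i j < entry T i' j.

Definition SET (a : seq nat) (T : filling) : Prop :=
  [/\ shape T = a, perm_eq (flatten T) (iota 1 (sumn a)),
      all (sorted ltn) T & columns_increase T].

Definition SE_decreasing (a : seq nat) (T : filling) : Prop :=
  forall i j : nat, i < j < size a -> nth 0 a j < nth 0 a i ->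
    forall k : nat, k < nth 0 a j -> entry T i k.+1 < entry T j k.

Definition SETsed (a : seq nat) (T : filling) : Prop :=
  SET a T /\ SE_decreasing a T.

Definition w_r (T : filling) : seq nat := flatten [seq rev r | r <- T].

(** Insertion *)

(* By decreasing column index and, within a column, decreasing row index. *)
Definition cells (T : filling) : seq (nat * nat) :=
  [seq (c, d) | d <- rev (iota 0 (\max_(r <- T) size r)),
                c <- [seq c <- rev (iota 0 (size T)) | is_cell T c d]].

Definition set_entry (T : filling) (i j x : nat) : filling :=
  set_nth [::] T i (set_nth 0 (frow T i) j x).

(* Adds the row [:: x] below the lowest row whose first entry exceeds [x]. *)
Definition add_row (T : filling) (x : nat) : filling :=
  let p := find (fun r => x < head 0 r) T in
  take p T ++ [:: x] :: drop p T.

(* The second component of the result is the column of the new cell. *)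
Fixpoint insert_along (cs : seq (nat * nat)) (k0 : nat) (T : filling)
    : filling * nat :=
  if cs is (c, d) :: cs' then
    if ~~ is_cell T c d.+1 && (entry T c d <= k0) then
      (set_entry T c d.+1 k0, d.+1)
    else if is_cell T c d.+1 && (entry T c d <= k0 < entry T c d.+1) then
      insert_along cs' (entry T c d.+1) (set_entry T c d.+1 k0)
    else insert_along cs' k0 T
  else (add_row T k0, 0).

(* The rule makes sense for every filling [T]; it is only ever applied to the
   Young composition tableaux obtained by insertions from the empty one. *)
Definition insert (k : nat) (T : filling) : filling * nat :=
  insert_along (cells T) k T.

(* Since columns are counted from 0, a new cell in column [c > 0] extends a row
   of [Q] having exactly [c] cells; the topmost one is the last one in [Q]. Such
   a row always exists, as [P] and [Q] have equally many rows of each size. *)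
Definition record_cell (Q : filling) (k c : nat) : filling :=
  if c == 0 then add_row Q k
  else
    let i := last 0 [seq i <- iota 0 (size Q) | size (frow Q i) == c] in
    set_entry Q i c k.

Definition PQ_step (PQ : filling * filling) (xk : nat * nat)
    : filling * filling :=
  let: (P, c) := insert xk.1 PQ.1 in (P, record_cell PQ.2 xk.2 c).

Definition PQ_word (w : seq nat) : filling * filling :=
  foldl PQ_step ([::], [::]) (zip w (iota 1 (size w))).

(** Permutations *)

(* One-line notation; ['I_n] is {0, ..., n-1}, hence the shift by one. *)
Definition one_line (n : nat) (s : 'S_n) : seq nat :=
  [seq (s i).+1 | i <- enum 'I_n].

Definition P_hat (n : nat) (s : 'S_n) : filling := (PQ_word (one_line s)).1.
Definition Q_hat (n : nat) (s : 'S_n) : filling := (PQ_word (one_line s)).2.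

Definition w0 (n : nat) : 'S_n := perm (@rev_ord_inj n).

Definition canonical_filling (a : seq nat) : filling :=
  reshape a (iota 1 (sumn a)).

(* Products in ['S_n] act from left to right ([permM]), so the permutation
   i |-> s (w0 i), whose word is the reversed word of s, is [w0 n * s]. *)
Definition K_set (n : nat) (a : seq nat) : {set 'S_n} :=
  [set s : 'S_n | (shape (P_hat (w0 n * s)%g) == a)
                  && (Q_hat (w0 n * s)%g == canonical_filling (rev a))].

(* Main.v *)
Require Import Defs.
From mathcomp Require Import all_boot all_fingroup.
From mathcomp Require Import zify.

(* Write the word reversed: w comes from T exactly when rev w lists the rows of
   T from top to bottom, so the rows are inserted one by one, each from left to
   right, and Q_hat is canonical iff the new cells of each row appear in columns
   0, 1, 2, ... in this order.

   Let P be the tableau produced by the rows above a row r, of size m.  Inserting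
   r adds a new bottom row without disturbing the relative order of the others
   iff r is increasing, the k-th entry of r is below column k of P, and the
   (k+1)-st entry of r is below the k-th entry of every row of P shorter than m.
   Then the k-th letter of r only affects column k, shorter rows stay put,
   and the insertion of the whole row r can be computed by letting r sweep P
   row by row from the top, exchanging entries with the rows of size m only;
   this is where the hypothesis on the shape is used.  Hence, for each row
   length, P and the rows of T above r have the same column sets, so that the
   condition may be read on T, where it says that T is increasing and
   SE-decreasing.

   Conversely, r is increasing because inserting x and then y < x creates the
   second new cell weakly to the left of the first.  An entry y not smaller than
   some entry of column p lands strictly to the right of column p; if a letter of
   r did so, all later ones would be shifted as well, giving a row longer than
   m.  That the other rows do not grow gives the condition on short rows. *)

Set Implicit Arguments.
Unset Strict Implicit.
Unset Printing Implicit Defensive.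

(** * Insertion, one column at a time *)


(** [None] means that the entry in transit has found its new cell, after which nothing changes any
    more. The column [d] is that of the cell being visited, so the entry that may change is the one
    in column [d.+1]. *)
Definition row_pass (d : nat) (s : option nat) (r : seq nat) :
    option nat * seq nat :=
  if s is Some k then
    if (d < size r) && (nth 0 r d <= k) then
      if d.+1 < size r then
        if k < nth 0 r d.+1 then (Some (nth 0 r d.+1), set_nth 0 r d.+1 k)
        else (s, r)
      else (None, rcons r k)
    else (s, r)
  else (s, r).

(** Rows are stored from bottom to top while a column is traversed downwards, so the tail is treated
    before the head. *)
Fixpoint col_pass (d : nat) (s : option nat) (T : filling) :
    option nat * filling :=
  if T is r :: T' then
    let: (s1, T1) := col_pass d s T' in
    let: (s2, r2) := row_pass d s1 r in (s2, r2 :: T1)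
  else (s, [::]).

(* Passes through columns n-1, ..., 0.  Returns the filling, the entry still to
   be placed, and the column of the new cell, or 0 if there is none so far. *)
Fixpoint run (n k : nat) (T : filling) : filling * (nat * nat) :=
  if n is d.+1 then
    let: (s, T') := col_pass d (Some k) T in
    if s is Some k' then run d k' T' else (T', (k, d.+1))
  else (T, (k, 0)).

Lemma set_nth_size (r : seq nat) x : set_nth 0 r (size r) x = rcons r x.
Proof. by elim: r => //= y r ->. Qed.

Lemma set_nth_cat_cons (A B : filling) r r' :
  set_nth [::] (A ++ r :: B) (size A) r' = A ++ r' :: B.
Proof. by elim: A => //= t A ->. Qed.

Lemma frow_cat_cons (A B : filling) r : frow (A ++ r :: B) (size A) = r.
Proof. by rewrite /frow nth_cat ltnn subnn. Qed.

Lemma col_pass_rcons d s A r :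
  col_pass d s (rcons A r) =
  let: (s1, r1) := row_pass d s r in
  let: (s2, A2) := col_pass d s1 A in (s2, rcons A2 r1).
Proof.
elim: A => [|t A IH] /=; first by case: row_pass.
rewrite IH; case: row_pass => s1 r1; case: col_pass => s2 A2.
by case: row_pass.
Qed.

Lemma col_pass_None d A : col_pass d None A = (None, A).
Proof. by elim: A => //= t A ->. Qed.

Lemma col_pass_cat d s A B :
  col_pass d s (A ++ B) =
  let: (s1, B1) := col_pass d s B in
  let: (s2, A2) := col_pass d s1 A in (s2, A2 ++ B1).
Proof.
elim: A => [|t A IH] /=; first by case: col_pass.
rewrite IH; case: (col_pass d s B) => s1 B1; case: col_pass => s2 A2.
by case: row_pass.
Qed.

(** Induction on the last row of [A], the first one visited; [B] holds the rows already passed. The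
    cells still listed lie in lower rows and do not depend on the row just changed ([sameA]). *)
Lemma insert_along_col d cs A B k :
  insert_along ([seq (c, d) | c <- rev (iota 0 (size A)) & is_cell (A ++ B) c d]
                ++ cs) k (A ++ B) =
  let: (s, A') := col_pass d (Some k) A in
  if s is Some k' then insert_along cs k' (A' ++ B) else (A' ++ B, d.+1).
Proof.
elim/last_ind: A B k => [|A r IH] B k //=.
rewrite size_rcons -addn1 iotaD rev_cat /= add0n col_pass_rcons !cat_rcons.
have cellE : forall r' j, is_cell (A ++ r' :: B) (size A) j = (j < size r').
  by move=> r' j; rewrite /is_cell frow_cat_cons.
have sameA r' : [seq (c, d) | c <- rev (iota 0 (size A)) & is_cell (A ++ r ::
  B) c d] =
  [seq (c, d) | c <- rev (iota 0 (size A)) & is_cell (A ++ r' :: B) c d].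
  congr map; apply: eq_in_filter => c; rewrite mem_rev mem_iota /= => lt_c.
  by rewrite /is_cell /frow !nth_cat lt_c.
rewrite cellE /=; have [lt_d|ge_d] /= := ltnP d (size r); last first.
  by rewrite IH; case: col_pass => [[k'|] A'] //; rewrite cat_rcons.
have entE j : entry (A ++ r :: B) (size A) j = nth 0 r j.
  by rewrite /entry frow_cat_cons.
rewrite !cellE !entE /set_entry frow_cat_cons !set_nth_cat_cons.
have [lt_d1|ge_d1] /= := ltnP d.+1 (size r).
  case: (leqP (nth 0 r d) k) => /= le1; last first.
    by rewrite IH; case: col_pass => [[k'|] A'] //; rewrite cat_rcons.
  case: (ltnP k (nth 0 r d.+1)) => /= lt2.
    rewrite (sameA (set_nth 0 r d.+1 k)) IH.
    by case: col_pass => [[k'|] A'] //; rewrite cat_rcons.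
  by rewrite IH; case: col_pass => [[k'|] A'] //; rewrite cat_rcons.
have dE : d.+1 = size r by apply/eqP; rewrite eqn_leq lt_d ge_d1.
case: (leqP (nth 0 r d) k) => /= le1.
  by rewrite dE set_nth_size col_pass_None cat_rcons.
by rewrite IH; case: col_pass => [[k'|] A'] //; rewrite cat_rcons.
Qed.

Lemma row_pass_size d k k' r r' :
  row_pass d (Some k) r = (Some k', r') -> size r' = size r.
Proof.
rewrite /row_pass; case: ifP => // H; last by case=> _ <-.
case: ifP => // H1; case: ifP => // _; last by case=> _ <-.
by case=> _ <-; rewrite size_set_nth; apply/maxn_idPr.
Qed.

Lemma row_pass_Some d s k r r' : row_pass d s r = (Some k, r') ->
  exists k0, s = Some k0.
Proof. by case: s => [k0|] //; exists k0. Qed.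

Lemma col_pass_shape d k k' T T' :
  col_pass d (Some k) T = (Some k', T') -> shape T' = shape T.
Proof.
elim: T k' T' => [|r T IH] k' T' /=; first by case=> _ <-.
case E: col_pass => [s1 T1]; case E2: row_pass => [s2 r2] [eqs <-].
rewrite eqs in E2; have [k0 s1E] := row_pass_Some E2.
by rewrite s1E in E E2; rewrite /= (row_pass_size E2) (IH _ _ E).
Qed.

Lemma is_cell_shape T T' c d : shape T = shape T' -> is_cell T c d = is_cell T' c d.
Proof.
move=> eqs; rewrite /is_cell /frow.
have E (U : filling) : size (nth [::] U c) = nth 0 (shape U) c.
  have [lt|ge] := ltnP c (size U); first by rewrite (nth_map [::]).
  by rewrite !nth_default // size_map.
by rewrite !E eqs.
Qed.

(** The list of cells is that of the tableau before insertion. It may be recomputed after each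
    column, since a pass that does not stop preserves the shape. *)
Lemma insert_along_run n T k :
  insert_along [seq (c, d) | d <- rev (iota 0 n),
     c <- [seq c <- rev (iota 0 (size T)) | is_cell T c d]] k T =
  let: (T', (k', c)) := run n k T in
  if c == 0 then (add_row T' k', 0) else (T', c).
Proof.
elim: n T k => [//|n IH] T k.
rewrite -{1}[n.+1]addn1 iotaD rev_cat /= add0n.
have := insert_along_col n [seq (c, d) | d <- rev (iota 0 n),
     c <- [seq c <- rev (iota 0 (size T)) | is_cell T c d]] T [::] k.
rewrite cats0 => ->.
case E: col_pass => [[k'|] T'] /=; rewrite ?cats0 //.
rewrite -IH; congr insert_along.
have eqs := col_pass_shape E.
have -> : size T' = size T by rewrite -(size_map size T') -[map _ _]/(shape T')
  eqs size_map.
congr flatten; apply: eq_map => d; congr map; apply: eq_filter => c.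
exact/esym/is_cell_shape.
Qed.

Lemma col_pass_big d s T : all (fun r => size r <= d) T ->
  col_pass d s T = (s, T).
Proof.
elim: T => //= r T IH /andP[le_r allT]; rewrite (IH allT).
by rewrite /row_pass; case: (s) => [k|] //; rewrite ltnNge le_r.
Qed.

Lemma run_big n m k T : all (fun r => size r <= m) T -> m <= n ->
  run n k T = run m k T.
Proof.
move=> allT; elim: n => [|n IH]; first by rewrite leqn0 => /eqP ->.
rewrite leq_eqVlt => /orP[/eqP -> //|lt_mn] /=.
rewrite col_pass_big ?IH //.
by apply: sub_all allT => r /leq_trans; apply.
Qed.

Lemma insert_run n k T : all (fun r => size r <= n) T ->
  insert k T = let: (T', (k', c)) := run n k T in
               if c == 0 then (add_row T' k', 0) else (T', c).
Proof.
move=> allT; rewrite /insert /cells insert_along_run -(@run_big n) //.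
  by apply/allP=> r rT; exact: leq_bigmax_seq.
by apply/bigmax_leqP_seq=> r rT _; exact: (allP allT).
Qed.

Arguments row_pass : simpl never.


(** The implication in [RowIdle] covers the three reasons for doing nothing: the row does not reach
    column [d], its entry there exceeds [k], or its next entry is already at most [k]. *)
Variant row_pass_spec d k r : option nat * seq nat -> Prop :=
| RowIdle of (d < size r -> nth 0 r d <= k ->
              d.+1 < size r /\ nth 0 r d.+1 <= k) :
    row_pass_spec d k r (Some k, r)
| RowSwap of d.+1 < size r & nth 0 r d <= k & k < nth 0 r d.+1 :
    row_pass_spec d k r (Some (nth 0 r d.+1), set_nth 0 r d.+1 k)
| RowStop of size r = d.+1 & nth 0 r d <= k :
    row_pass_spec d k r (None, rcons r k).

Lemma row_passP d k r : row_pass_spec d k r (row_pass d (Some k) r).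
Proof.
rewrite /row_pass; have [lt_d|ge_d] /= := ltnP d (size r); last first.
  by constructor; rewrite ltnNge ge_d.
have [le1|gt1] /= := leqP (nth 0 r d) k; last first.
  by constructor=> _; rewrite leqNgt gt1.
have [lt_d1|ge_d1] /= := ltnP d.+1 (size r).
  have [lt2|ge2] := ltnP k (nth 0 r d.+1); first by constructor.
  by constructor.
by constructor=> //; apply/eqP; rewrite eqn_leq lt_d ge_d1.
Qed.

(** * Invariants of an insertion: content, sorted rows, shape *)

Lemma perm_set_nth (r : seq nat) i x : i < size r ->
  perm_eq (nth 0 r i :: set_nth 0 r i x) (x :: r).
Proof.
elim: r i => [|y r IH] [|i] //= lt_i; apply/seq.permP => p /=; first lia.
by have := seq.permP (IH i lt_i) p => /=; lia.
Qed.

Lemma row_pass_perm d s r s1 r1 : row_pass d s r = (s1, r1) ->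
  perm_eq (seq_of_opt s1 ++ r1) (seq_of_opt s ++ r).
Proof.
case: s => [k|]; last by case=> <- <-.
case: row_passP => [_|lt _ _|_ _] [<- <-] //=; last by rewrite perm_rcons.
exact: perm_set_nth.
Qed.

Lemma col_pass_perm d s T s1 T1 : col_pass d s T = (s1, T1) ->
  perm_eq (seq_of_opt s1 ++ flatten T1) (seq_of_opt s ++ flatten T).
Proof.
elim: T s1 T1 => [|r T IH] s1 T1 /=; first by case=> <- <-.
case E: col_pass => [s' T']; case E2: row_pass => [s2 r2] [<- <-] /=.
rewrite catA.
apply: (@perm_trans _ ((seq_of_opt s' ++ r) ++ flatten T')).
  by rewrite perm_cat2r (row_pass_perm E2).
rewrite -catA perm_catCA perm_sym perm_catCA perm_cat2l perm_sym.
exact: IH E.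
Qed.

Lemma run_perm n k T T1 k1 c : run n k T = (T1, (k1, c)) ->
  perm_eq (if c == 0 then k1 :: flatten T1 else flatten T1) (k :: flatten T).
Proof.
elim: n k T => [|d IH] k T /=; first by case=> <- <- <-.
case E: col_pass => [[k'|] T'] => [/IH|[<- _ <-]] /=; have := col_pass_perm E.
  by move=> /= H /perm_trans; apply.
by [].
Qed.

Lemma run_col n k T : (run n k T).2.2 <= n.
Proof.
elim: n k T => //= d IH k T; case: col_pass => [[k'|] T'] //=.
exact: leq_trans (IH _ _) _.
Qed.

Lemma add_row_cat T k : exists A B, [/\ T = A ++ B, add_row T k = A ++ [:: k] :: B,
  all (fun r => head 0 r <= k) A & B != [::] -> k < head 0 (head [::] B)].
Proof.
rewrite /add_row; set p := find _ _; exists (take p T), (drop p T).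
split; rewrite ?cat_take_drop //.
  apply/(all_nthP [::]) => i; rewrite size_take_min leq_min => /andP[lt_i lt_T].
  by rewrite nth_take // leqNgt; apply/negbT; apply: (before_find [::] lt_i).
have [lt_p|ge_p] := ltnP p (size T); last by rewrite drop_oversize.
by move=> _; rewrite -(nth0 [::]) nth_drop addn0;
  apply: (@nth_find _ [::] (fun r => k < head 0 r)); rewrite has_find.
Qed.

Definition colmax (T : filling) := \max_(r <- T) size r.

Lemma colmaxP n T : colmax T <= n -> all (fun r => size r <= n) T.
Proof. by move=> le; apply/allP => r rT; apply: leq_trans le;
  exact: leq_bigmax_seq. Qed.

(** The bound [n] is left free so that two successive insertions can be run with the same number of
    passes. *)
Lemma insert_colmax T k n : colmax T <= n -> insert k T =
  let: (T', (k', c)) := run n k T in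
               if c == 0 then (add_row T' k', 0) else (T', c).
Proof. by move=> /colmaxP; exact: insert_run. Qed.

Lemma insert_perm k T : perm_eq (flatten (insert k T).1) (k :: flatten T).
Proof.
rewrite (@insert_colmax T k _ (leqnn _)).
case E: run => [T1 [k1 c]]; have := run_perm E.
case: eqP => //= _ H; apply: perm_trans H.
have [A [B [-> -> _ _]]] := add_row_cat T1 k1.
by rewrite !flatten_cat /= -[k1 :: _]/([:: k1] ++ _) perm_catCA.
Qed.

Lemma row_pass_sorted d s r s1 r1 : row_pass d s r = (s1, r1) ->
  sorted leq r -> sorted leq r1.
Proof.
case: s => [k|]; last by case=> _ <-.
case: row_passP => [_|lt le1 lt2|sz le1] [_ <-] // /(sortedP 0) H.
  apply/(sortedP 0) => i; rewrite size_set_nth (maxn_idPr lt) !nth_set_nth /=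
    eqSS => lt_i.
  have Hi := H i lt_i; have [ei|ne1] := eqVneq i d.+1.
    have -> : (i == d) = false by lia.
    by rewrite ei in Hi *; lia.
  by have [->|ne2] := eqVneq i d.
apply/(sortedP 0) => i; rewrite size_rcons ltnS => lt_i.
rewrite !nth_rcons lt_i; case: ltnP => [|ge]; first exact: H.
have/eqP: i.+1 == size r by rewrite eqn_leq lt_i ge.
by rewrite sz => -[->]; rewrite eqxx.
Qed.

Lemma col_pass_sorted d s T s1 T1 : col_pass d s T = (s1, T1) ->
  all (sorted leq) T -> all (sorted leq) T1.
Proof.
elim: T s1 T1 => [|r T IH] s1 T1 /=; first by case=> _ <-.
case E: col_pass => [s' T']; case E2: row_pass => [s2 r2] [_ <-] /= /andP[H1 H2].
by rewrite (row_pass_sorted E2) ?(IH _ _ E).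
Qed.

Lemma run_sorted n k T : all (sorted leq) T -> all (sorted leq) (run n k T).1.
Proof.
elim: n k T => //= d IH k T H.
case E: col_pass => [[k'|] T'] /=; last exact: col_pass_sorted E _.
by apply: IH; exact: col_pass_sorted E _.
Qed.

Lemma insert_sorted k T : all (sorted leq) T -> all (sorted leq) (insert k T).1.
Proof.
move=> H; rewrite (@insert_colmax T k _ (leqnn _)).
have := run_sorted (colmax T) k H.
case: run => [T1 [k1 c]] /=; case: eqP => //= _.
by have [A [B [-> -> _ _]]] := add_row_cat T1 k1; rewrite !all_cat.
Qed.

Lemma row_pass_le d k r k1 r1 : row_pass d (Some k) r = (Some k1, r1) -> k <= k1.
Proof. by case: row_passP => [_|_ _ lt|//] [<- _] //; exact: ltnW. Qed.

Lemma col_pass_le d k T k1 T1 : col_pass d (Some k) T = (Some k1, T1) -> k <= k1.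
Proof.
elim: T k1 T1 => [|r T IH] k1 T1 /=; first by case=> <-.
case E: col_pass => [[s'|] T'] //; case E2: row_pass => [s2 r2] [E3 _] //.
by rewrite E3 in E2; apply: leq_trans (IH _ _ E) (row_pass_le E2).
Qed.

Lemma run_le n k T T1 k1 : run n k T = (T1, (k1, 0)) -> k <= k1.
Proof.
elim: n k T => [|d IH] k T /=; first by case=> _ <-.
case E: col_pass => [[k'|] T'] // /IH; exact: leq_trans (col_pass_le E).
Qed.

Lemma col_pass_shape_None d k T T1 : col_pass d (Some k) T = (None, T1) ->
  exists A B, shape T = A ++ d.+1 :: B /\ shape T1 = A ++ d.+2 :: B.
Proof.
elim: T T1 => [|r T IH] T1 //=.
case E: col_pass => [[k'|] T']; last first.
  by case=> <-; have [A [B [eA eB]]] := IH _ E; exists (size r :: A), B => /=;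
    rewrite eA eB.
case: row_passP => [//|//|sz _] [<-] /=.
by exists [::], (shape T); rewrite size_rcons sz (col_pass_shape E).
Qed.

Lemma run_shape n k T T1 k1 c : run n k T = (T1, (k1, c)) ->
  if c == 0 then shape T1 = shape T
  else exists A B, shape T = A ++ c :: B /\ shape T1 = A ++ c.+1 :: B.
Proof.
elim: n k T => [|d IH] k T /=; first by case=> <- _ <-.
case E: col_pass => [[k'|] T'].
  by move=> /IH; rewrite (col_pass_shape E).
by case=> <- _ <- /=; exact: col_pass_shape_None E.
Qed.

Lemma insert_shape k T T1 c : insert k T = (T1, c) ->
  exists A B, if c == 0 then shape T = A ++ B /\ shape T1 = A ++ 1 :: B
  else shape T = A ++ c :: B /\ shape T1 = A ++ c.+1 :: B.
Proof.
rewrite (@insert_colmax T k _ (leqnn _)).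
case E: run => [T' [k1 c']]; have := run_shape E.
case: ifP => [_ shE [<- <-] /=|nz H [<- <-]]; last by rewrite nz.
have [A [B [eT -> _ _]]] := add_row_cat T' k1.
by exists (shape A), (shape B); rewrite -shE eT /shape !map_cat.
Qed.

(** * Successive insertions *)


(* f can arise from the row t when entries at least x pass columns n-1, ..., 0. *)
Definition grown n x (t f : seq nat) : Prop :=
  (size f = size t \/
   size f = (size t).+1 /\ size t <= n /\ x <= nth 0 f (size t)) /\
  (forall j, j < size t -> nth 0 f j = nth 0 t j \/ (j <= n /\ x <= nth 0 f j)).

Lemma grown_refl n x t : grown n x t t.
Proof. by split; left. Qed.

Lemma row_pass_grown d k r x : x <= k ->
  grown d.+1 x r (row_pass d (Some k) r).2.
Proof.
move=> le_xk; case: row_passP => [_|lt le1 lt2|sz le1] /=; first exact: grown_refl.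
  split; first by left; rewrite size_set_nth; apply/maxn_idPr.
  move=> j lt_j; rewrite nth_set_nth /=; case: eqP => [->|_]; last by left.
  by right.
split; first by right; rewrite size_rcons nth_rcons ltnn eqxx sz.
by move=> j lt_j; rewrite nth_rcons lt_j; left.
Qed.

Lemma grown_trans n x x1 t t1 f : grown n.+1 x t t1 -> size t1 = size t ->
  x <= x1 -> grown n x1 t1 f -> grown n.+1 x t f.
Proof.
move=> [_ H1] sz le_x [H2 H3]; split.
  by case: H2 => [->|[-> [H4 H5]]]; [left|right; rewrite -sz; do !split=> //; lia].
move=> j lt_j; have := H1 j lt_j; rewrite -sz in lt_j; have := H3 j lt_j; lia.
Qed.

Lemma col_pass_grown d k T x i : x <= k ->
  grown d.+1 x (nth [::] T i) (nth [::] (col_pass d (Some k) T).2 i).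
Proof.
move=> le_xk; elim: T i => [|r T IH] [|i] /=; try exact: grown_refl.
  case E: col_pass => [[k'|] T'] /=; last exact: grown_refl.
  have := @row_pass_grown d k' r x (leq_trans le_xk (col_pass_le E)).
  by case: row_pass.
by move: (IH i); case E: col_pass => [s' T'] /=; case: row_pass.
Qed.

Lemma nth_shape_size (T : filling) i : size (nth [::] T i) = nth 0 (shape T) i.
Proof.
have [lt|ge] := ltnP i (size T); first by rewrite (nth_map [::]).
by rewrite !nth_default // size_map.
Qed.

Lemma run_grown n k T i : grown n k (nth [::] T i) (nth [::] (run n k T).1 i).
Proof.
elim: n k T => [|d IH] k T /=; first exact: grown_refl.
have := @col_pass_grown d k T k i (leqnn k).
case E: col_pass => [[k'|] T'] //= H; apply: grown_trans H _ (col_pass_le E)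
  (IH _ _).
by rewrite !nth_shape_size (col_pass_shape E).
Qed.

Lemma take_agree (u f : seq nat) n : take n.+1 u = take n.+1 f ->
  forall j, j <= n -> nth 0 u j = nth 0 f j /\ (j < size u) = (j < size f).
Proof.
move=> eqt j le_j; split; first by rewrite -(nth_take 0 (_ : j < n.+1)) // eqt
  nth_take.
have : (j < size (take n.+1 u)) = (j < size (take n.+1 f)) by rewrite eqt.
by rewrite !size_take_min; lia.
Qed.

Lemma take_set_nth (r : seq nat) i x :
  i < size r -> take i (set_nth 0 r i x) = take i r.
Proof. by move=> lt; rewrite set_nthE lt take_size_cat // size_takel // ltnW. Qed.

(** Later passes turn [t1] into [f] and place only entries at least [X], so an entry of [f] in
    column [d] that is at most [ky] was already in [t]. This excludes a stop. In a swap, [ky] is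
    exchanged with [k] itself if [t] swapped, and otherwise with an entry of [t] that is at most
    [k]; [k \notin t] then makes the inequality strict. *)
Lemma row_pass_follow d k t k' t1 X f u ky :
  row_pass d (Some k) t = (Some k', t1) -> grown d X t1 f -> k' <= X ->
  take d.+2 u = take d.+2 f -> k \notin t -> ky < k ->
  exists ky' u1, [/\ row_pass d (Some ky) u = (Some ky', u1), ky' < k'
    & take d.+1 u1 = take d.+1 u].
Proof.
move=> Et [szf Hf] le_X /take_agree Hu kt lt_ky.
have [ud szd] := Hu d (leqnSn d); have [ud1 szd1] := Hu d.+1 (leqnn _).
have kne : d.+1 < size t -> nth 0 t d.+1 <> k.
  by move=> lt e; move: kt; rewrite -e mem_nth.
have Hfd := Hf d; have Hfd1 := Hf d.+1.
move: Et; case: row_passP => [idle|lt le1 lt2|//] [ek et].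
- rewrite -ek -et in le_X szf Hfd Hfd1 *.
  case: row_passP => [_|lt le1 lt2|sz le1].
  + by exists ky, u.
  + exists (nth 0 u d.+1), (set_nth 0 u d.+1 ky); split=> //; first lia.
    exact: take_set_nth.
  + exfalso; case: szf => [szf|[szf [_ le_f]]]; first lia.
    have et' : size t = d by lia.
    by rewrite et' in le_f; lia.
- have szt1 : size t1 = size t by rewrite -et size_set_nth; apply/maxn_idPr.
  rewrite -ek in le_X *; rewrite szt1 -et !nth_set_nth /= eqxx in Hfd Hfd1 szf.
  case: row_passP => [_|ltu le1u lt2u|sz le1u].
  + by exists ky, u; split=> //; lia.
  + exists (nth 0 u d.+1), (set_nth 0 u d.+1 ky); split=> //; first lia.
    exact: take_set_nth.
  + exfalso; case: szf => [szf|[szf [_ le_f]]]; first lia.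
    have et' : size t = d by lia.
    by rewrite et' in le_f; lia.
Qed.

Lemma col_pass_follow d x T x1 T1 X F y U :
  col_pass d (Some x) T = (Some x1, T1) ->
  (forall i, grown d X (nth [::] T1 i) (nth [::] F i)) -> x1 <= X ->
  size U = size T ->
  (forall i, take d.+2 (nth [::] U i) = take d.+2 (nth [::] F i)) ->
  uniq (x :: flatten T) -> y < x ->
  exists y1 U1, [/\ col_pass d (Some y) U = (Some y1, U1), y1 < x1
    & forall i, take d.+1 (nth [::] U1 i) = take d.+1 (nth [::] U i)].
Proof.
elim: T x1 T1 F U => [|t T IH] x1 T1 F [|u U] //=.
  by case=> <- _ _ _ _ _ _ lt_y; exists y, [::].
case E: col_pass => [[k|] T'] //; case E2: row_pass => [s2 t1] [es <-] grF le_X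
  [szU] takeU.
move=> /andP[xN]; rewrite cat_uniq => /and3P[_ disj uT] lt_y; rewrite {}es in E2.
move: xN; rewrite mem_cat negb_or => /andP[xt xT].
have uxT : uniq (x :: flatten T) by rewrite /= xT.
have [|||y' [U' [-> lt_y' takeU']]] := IH k T' (behead F) U E _ _ szU _ uxT lt_y.
- by move=> i; rewrite nth_behead; exact: (grF i.+1).
- exact: leq_trans (row_pass_le E2) le_X.
- by move=> i; rewrite nth_behead; exact: (takeU i.+1).
have kt : k \notin t.
  apply/negP => kt; have := col_pass_perm E => /= /perm_mem/(_ k).
  rewrite !inE eqxx /= => /esym/orP[/eqP ek|kT]; first by rewrite -ek kt in xt.
  by move/hasP: disj; apply; exists k.
have [ky [u1 [-> lt_ky take_u1]]] := row_pass_follow E2 (grF 0) le_X (takeU 0)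
  kt lt_y'.
by exists ky, (u1 :: U'); split=> // -[|i] //=.
Qed.

(* U is the state of the insertion of y into F once columns n, n+1, ... have been
   passed; the invariant is that y stays behind x. *)
Lemma run_weak_left n x T F x1 c y U : run n x T = (F, (x1, c)) ->
  size U = size T ->
  (forall i, take n.+1 (nth [::] U i) = take n.+1 (nth [::] F i)) ->
  uniq (x :: flatten T) -> y < x ->
  (run n y U).2.2 <= c /\ (c = 0 -> (run n y U).2.1 < x1).
Proof.
elim: n x T y U => [|d IH] x T y U.
  by move=> /= -[_ <- <-].
rewrite [run _ x T]/=; case E: col_pass => [[k|] T'] => [R|[_ _ <-] _ _ _ _];
  last first.
  by split=> //; exact: run_col.
move=> szU takeU uT lt_y.
have grF i : grown d k (nth [::] T' i) (nth [::] F i).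
  by have := run_grown d k T' i; rewrite R.
have [y' [U' [E' lt_y' takeU']]] := col_pass_follow E grF (leqnn k) szU takeU
  uT lt_y.
rewrite /= E'; apply: IH R _ _ _ lt_y'.
- have := congr1 size (col_pass_shape E); have := congr1 size (col_pass_shape E').
  by rewrite !size_map szU => -> ->.
- move=> i; rewrite takeU'; have := congr1 (take d.+1) (takeU i).
  by rewrite !take_takel.
- by rewrite (perm_uniq (col_pass_perm E)).
Qed.

(** A row of length 1 could only react in the pass through column 0. The entry in transit never
    decreases, so there it is still at most [y1], hence below [z]. *)
Lemma run_new_row n y A B F z y1 : run n y (A ++ B) = (F, (y1, 0)) -> y1 < z ->
  (run n y (A ++ [:: z] :: B)).2.2 = 0.
Proof.
elim: n y A B => //= d IH y A B; rewrite !col_pass_cat /=.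
case: (col_pass d (Some y) B) => [[k|] B1]; last by rewrite col_pass_None.
case E: (col_pass d (Some k) A) => [[k'|] A1] // R lt_y1.
have -> : row_pass d (Some k) [:: z] = (Some k, [:: z]).
  rewrite /row_pass /= ltnS leqn0; case: eqP => //= ->.
  by rewrite /= leqNgt (leq_ltn_trans _ lt_y1) // (leq_trans (col_pass_le E))
    // (run_le R).
by rewrite E; apply: IH R lt_y1.
Qed.

(** By contraposition. If [x] extends a row, [run_weak_left] applies directly. If [x] starts a row,
    [run_weak_left] is applied to the tableau without that row, and [run_new_row] shows that adding
    it changes nothing for [y]. *)
Lemma insert_lt_col x y T T1 T2 cx cy : insert x T = (T1, cx) ->
  insert y T1 = (T2, cy) -> uniq [:: x, y & flatten T] -> cx < cy -> x < y.
Proof.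
set n := maxn (colmax T) (colmax T1).
rewrite (@insert_colmax T x n) ?leq_maxl //; case E: run => [T' [k c]] E1.
rewrite (@insert_colmax T1 y n) ?leq_maxr //; case Ey: run => [T2' [ky cy']] E2.
rewrite /= inE negb_or => /andP[/andP[ne_xy xT] /andP[_ uT]] lt_c.
have ecy : cy = cy' by case: eqP E2 => [->|_] [].
rewrite ltn_neqAle ne_xy leqNgt /=; apply/negP => lt_y.
have [||cT0 kT0] := @run_weak_left n x T T' k c y T' E _ (fun=> erefl) _ lt_y.
- have := run_shape E; case: ifP => _; first by move=> /(congr1 size);
    rewrite !size_map.
  move=> [A [B [eA eB]]]; have := congr1 size eA; have := congr1 size eB.
  by rewrite !size_map !size_cat => -> ->.
- by rewrite /= xT.
move: E1; have [c0|nz] := eqVneq c 0 => -[eT1 ecx]; last first.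
  by move: cT0; rewrite eT1 Ey /=; lia.
rewrite c0 in cT0 kT0 *.
have [A [B [eT eA _ _]]] := add_row_cat T' k.
move: cT0 (kT0 erefl); case Ey': run => [F [y1 c1]] /=;
  rewrite leqn0 => /eqP c10 lt_y1.
have := @run_new_row n y A B F k y1; rewrite -eT Ey' c10 -eA eT1 Ey /= => /(_
  erefl lt_y1).
lia.
Qed.

(** * Insertion of words *)


Lemma col_pass_place d y T :
  (col_pass d (Some y) T = (Some y, T) /\
   forall t, t \in T -> d < size t -> nth 0 t d <= y ->
     d.+1 < size t /\ nth 0 t d.+1 <= y) \/
  exists i, d.+1 < size (nth [::] (col_pass d (Some y) T).2 i) /\
    nth 0 (nth [::] (col_pass d (Some y) T).2 i) d.+1 = y.
Proof.
elim: T => [|r T IH] /=; first by left.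
case: IH => [[-> H]|[i Hi]]; last first.
  right; exists i.+1; move: Hi; case: col_pass => [s T'] /=.
  by case: row_pass.
case: row_passP => [Hr|lt le1 lt2|sz le1] /=.
- by left; split=> // t; rewrite inE => /orP[/eqP ->|]; [exact: Hr|exact: H].
- right; exists 0 => /=; rewrite nth_set_nth /= eqxx; split=> //.
  by rewrite size_set_nth (maxn_idPr lt).
- by right; exists 0 => /=; rewrite nth_rcons size_rcons sz ltnn eqxx.
Qed.

(** An idle pass hands the invariant that [y] is below the entry of [t] in the current column on to
    the next column on the left. It fails in column [p], so some pass through a column [d >= p]
    places [y] in column [d.+1], which later passes do not reach. *)
Lemma run_place n y T t p : t \in T -> p < size t -> nth 0 t p <= y -> p < n ->
  (n < size t -> y < nth 0 t n) ->
  exists i q, p < q < size (nth [::] (run n y T).1 i) /\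
    nth 0 (nth [::] (run n y T).1 i) q = y.
Proof.
move=> tT lt_p le_y; elim: n => // d IH lt_pd Hn /=.
have [[-> H]|[i]] := col_pass_place d y T.
  have Hd : d < size t -> y < nth 0 t d.
    move=> lt_d; rewrite ltnNge; apply/negP => le_d.
    by have [lt2 le2] := H t tT lt_d le_d; have := Hn lt2; rewrite ltnNge le2.
  apply: IH => //; rewrite ltn_neqAle -ltnS lt_pd andbT.
  by apply/eqP => e; rewrite -e in Hd; have := Hd lt_p; rewrite ltnNge le_y.
case E: (col_pass d (Some y) T) => [[k|] T'] /= [lt_d e]; last first.
  by exists i, d.+1; rewrite lt_d andbT.
have [szf Hf] := run_grown d k T' i.
exists i, d.+1; have := Hf d.+1 lt_d; rewrite ltnn e => -[->|[]//].
by rewrite lt_pd; case: szf => [->|[-> _]] //; rewrite ltnS ltnW.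
Qed.

Lemma mem_nth_row (T : filling) i q : q < size (nth [::] T i) -> nth [::] T i \in T.
Proof. by have [lt|ge] := ltnP i (size T);
  [rewrite mem_nth | rewrite nth_default]. Qed.

Lemma insert_place y T t p : t \in T -> p < size t -> nth 0 t p <= y ->
  exists t' q, [/\ t' \in (insert y T).1, p < q < size t' & nth 0 t' q = y].
Proof.
move=> tT lt_p le_y; rewrite (@insert_colmax T y _ (leqnn _)).
have le_t : size t <= colmax T by exact: leq_bigmax_seq.
have [||i [q []]] := @run_place (colmax T) y T t p tT lt_p le_y.
- exact: leq_trans le_t.
- by rewrite ltnNge le_t.
case: run => [T' [k c]] /= lt_q e; exists (nth [::] T' i), q; split=> //.
have mem_i : nth [::] T' i \in T' by case/andP: lt_q => _; exact: mem_nth_row.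
case: eqP => //= _; have [A [B [eT -> _ _]]] := add_row_cat T' k.
by move: mem_i; rewrite {2}eT !mem_cat inE => /orP[->|->]; rewrite ?orbT.
Qed.

Fixpoint insert_word (T : filling) (r : seq nat) : filling :=
  if r is x :: r' then insert_word (insert x T).1 r' else T.

Fixpoint new_cols (T : filling) (r : seq nat) : seq nat :=
  if r is x :: r' then (insert x T).2 :: new_cols (insert x T).1 r' else [::].

Lemma insert_word_cat T u v : insert_word T (u ++ v) = insert_word (insert_word
  T u) v.
Proof. by elim: u T => //= x u IH T. Qed.

Lemma new_cols_cat T u v :
  new_cols T (u ++ v) = new_cols T u ++ new_cols (insert_word T u) v.
Proof. by elim: u T => //= x u IH T; rewrite IH. Qed.

Lemma size_new_cols T u : size (new_cols T u) = size u.
Proof. by elim: u T => //= x u IH T; rewrite IH. Qed.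

Lemma insert_word_perm T r : perm_eq (flatten (insert_word T r)) (r ++ flatten T).
Proof.
elim: r T => //= x r IH T; apply: perm_trans (IH _) _.
apply: perm_trans (_ : perm_eq _ (r ++ x :: flatten T)) _.
  by rewrite perm_cat2l insert_perm.
by rewrite -[x :: flatten T]/([:: x] ++ _) perm_catCA.
Qed.

Lemma insert_word_sorted T r :
  all (sorted leq) T -> all (sorted leq) (insert_word T r).
Proof. by elim: r T => //= x r IH T H; apply: IH; exact: insert_sorted. Qed.

Lemma sorted_of_new_cols T r j : uniq (r ++ flatten T) ->
  new_cols T r = iota j (size r) -> sorted ltn r.
Proof.
elim: r T j => // x [//|y r] IH T j uT /= [ex ey er].
have uT' : uniq [:: x, y & flatten T].
  move: uT; rewrite /= !inE !mem_cat !negb_or cat_uniq.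
  by case/and4P=> /and3P[-> _ ->] /andP[_ ->] _ /andP[_ ->].
rewrite (@insert_lt_col x y T (insert x T).1 (insert y (insert x T).1).1 j
  j.+1) //=.
- apply: (IH (insert x T).1 j.+1); last by rewrite /= ey er.
  rewrite (perm_uniq (_ : perm_eq _ ((y :: r) ++ x :: flatten T))) ?perm_cat2l
    ?insert_perm //.
  by rewrite -[x :: flatten T]/([:: x] ++ _) uniq_catCA.
- by rewrite -ex; case: insert.
- by rewrite -ey; case: insert.
Qed.

Lemma nth_sorted_leq (t : seq nat) i j : sorted leq t -> i <= j -> j < size t ->
  nth 0 t i <= nth 0 t j.
Proof.
move=> st le_ij lt_j; apply: (sorted_leq_nth leq_trans leqnn) => //.
exact: leq_ltn_trans lt_j.
Qed.

(* An entry landing beyond column j pushes every later entry of the word one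
   column further. *)
Lemma insert_word_long_row T x r t j : all (sorted leq) T -> sorted ltn (x :: r) ->
  t \in T -> j < size t -> nth 0 t j <= x ->
  exists2 t', t' \in insert_word T (x :: r) & j + size (x :: r) < size t'.
Proof.
elim: r T x t j => [|y r IH] T x t j sT sr tT lt_j le_x.
  have [t' [q [t'T /andP[lt_q lt_q'] _]]] := insert_place tT lt_j le_x.
  by exists t' => //=; rewrite addn1; exact: leq_ltn_trans lt_q'.
have [t' [q [t'T /andP[lt_q lt_q'] eq_x]]] := insert_place tT lt_j le_x.
move: sr => /= /andP[lt_xy sr].
have sT' := insert_sorted x sT.
have [||t2 t2T lt_t2] := IH (insert x T).1 y t' j.+1 sT' sr t'T.
- exact: leq_ltn_trans lt_q'.
- apply: leq_trans (ltnW lt_xy); rewrite -eq_x.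
  exact: nth_sorted_leq (allP sT' _ t'T) _ _.
by exists t2 => //; rewrite /= addnS -addSn.
Qed.

Lemma run_pass n d y T : all (sorted leq) T ->
  (forall t, t \in T -> d < size t -> y < nth 0 t d) -> d <= n ->
  run n y T = run d y T.
Proof.
move=> sT H; elim: n => [|n IH]; first by rewrite leqn0 => /eqP ->.
rewrite leq_eqVlt => /orP[/eqP -> //|le_dn]; rewrite -(IH le_dn) /=.
suff -> : col_pass n (Some y) T = (Some y, T) by [].
elim: T sT H {IH} => //= t T IH /andP[st sT] H.
rewrite IH //; last by move=> u uT; apply: H; rewrite inE uT orbT.
rewrite /row_pass; case: ifP => // /andP[lt_n le_n]; exfalso.
have lt_d : d < size t by exact: leq_ltn_trans lt_n.
have := H t (mem_head _ _) lt_d; have := nth_sorted_leq st (ltnSE le_dn) lt_n; lia.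
Qed.

Lemma insert_min x T : all (sorted leq) T ->
  (forall t, t \in T -> 0 < size t /\ x < nth 0 t 0) -> insert x T = ([:: x] ::
    T, 0).
Proof.
move=> sT H; rewrite (@insert_colmax T x _ (leqnn _)) (@run_pass _ 0) //=.
  case: T {sT} H => //= t T H; rewrite /add_row /=.
  by have [_] := H t (mem_head _ _); rewrite nth0 => ->.
by move=> t /H[].
Qed.

Definition shape_le (s s' : seq nat) : Prop :=
  size s = size s' /\ forall i, nth 0 s i <= nth 0 s' i.

Lemma insert_word_shape_le T r : all (leq 1) (new_cols T r) ->
  shape_le (shape T) (shape (insert_word T r)).
Proof.
elim: r T => //= x r IH T /andP[c1 /IH[sz le]].
case E: (insert x T) c1 sz le => [T1 c] /= c1 sz le.
have [A [B]] := insert_shape E; rewrite gtn_eqF // => -[eT eT1].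
rewrite eT; rewrite eT1 in sz le; split; first by rewrite -sz !size_cat.
move=> i; apply: leq_trans (le i); rewrite !nth_cat; case: ifP => // _.
by case: (i - size A).
Qed.

(** * Sweeping a row through a tableau *)


(* A word v sweeps a row t: its k-th letter only meets the k-th entry of t, after
   the previous letters have modified t. *)
Fixpoint swaps (v t : seq nat) (k : nat) : bool :=
  if k is j.+1 then
    [&& k < size t, (if swaps v t j then nth 0 v j else nth 0 t j) <= nth 0 v k
      & nth 0 v k < nth 0 t k]
  else false.

Definition passed (v t : seq nat) : seq nat :=
  mkseq (fun k => if swaps v t k then nth 0 t k else nth 0 v k) (size v).

(** The test [k < size v] keeps the default letter 0 beyond the end of [v] from being stored in the
    row. *)
Definition kept (v t : seq nat) : seq nat :=
  mkseq (fun k => if (k < size v) && swaps v t k then nth 0 v k else nth 0 t k)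
    (size t).

(** The head of [P] is its bottom row, so the word meets the top row first; what finally leaves [P]
    becomes the new bottom row. *)
Fixpoint sweep_word (v : seq nat) (P : filling) : seq nat :=
  if P is t :: A then passed (sweep_word v A) t else v.

Fixpoint sweep_rows (v : seq nat) (P : filling) : filling :=
  if P is t :: A then kept (sweep_word v A) t :: sweep_rows v A else [::].

(** No letter can be placed right after an entry of [t]: the row neither swaps nor grows. *)
Definition idle (v t : seq nat) : Prop :=
  forall k, k < size t -> k.+1 < size v -> nth 0 v k.+1 < nth 0 t k.

(** Letter [k.+1] can only extend a row of length [k.+1], so a row at least as long as [v] never
    grows; of a shorter row idleness is demanded. *)
Fixpoint nonstop (v : seq nat) (P : filling) : Prop :=
  if P is t :: A then
    (idle (sweep_word v A) t \/ size v <= size t) /\ nonstop v A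
  else True.

Lemma swaps_size v t k : swaps v t k -> k < size t.
Proof. by case: k => //= k /and3P[]. Qed.

Lemma swaps_lt v t k : swaps v t k -> nth 0 v k < nth 0 t k.
Proof. by case: k => //= k /and3P[]. Qed.

Lemma swaps_rcons v y t k : k < size v -> swaps (rcons v y) t k = swaps v t k.
Proof.
elim: k => //= k IH lt_k; rewrite (IH (ltnW lt_k)) !nth_rcons lt_k.
by rewrite (ltnW lt_k).
Qed.

Lemma size_passed v t : size (passed v t) = size v.
Proof. exact: size_mkseq. Qed.

Lemma size_kept v t : size (kept v t) = size t.
Proof. exact: size_mkseq. Qed.

Lemma nth_passed v t k : k < size v ->
  nth 0 (passed v t) k = if swaps v t k then nth 0 t k else nth 0 v k.
Proof. by move=> lt; rewrite nth_mkseq. Qed.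

Lemma nth_kept v t k : k < size t ->
  nth 0 (kept v t) k = if (k < size v) && swaps v t k then nth 0 v k else nth 0 t k.
Proof. by move=> lt; rewrite nth_mkseq. Qed.

Lemma size_sweep_word v P : size (sweep_word v P) = size v.
Proof. by elim: P => //= t A IH; rewrite size_passed. Qed.

Lemma shape_sweep_rows v P : shape (sweep_rows v P) = shape P.
Proof. by elim: P => //= t A ->; rewrite size_kept. Qed.

Lemma passed_rcons v y t : passed (rcons v y) t =
  rcons (passed v t) (if swaps (rcons v y) t (size v) then nth 0 t (size v) else y).
Proof.
apply: (@eq_from_nth _ 0); first by rewrite size_passed !size_rcons size_passed.
move=> k; rewrite size_passed size_rcons ltnS leq_eqVlt => /orP[/eqP ->|lt_k].
  by rewrite nth_passed ?size_rcons // !nth_rcons size_passed ltnn eqxx.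
rewrite nth_passed ?size_rcons ?(ltnW lt_k) ?ltnS 1?ltnW //.
by rewrite [RHS]nth_rcons size_passed lt_k nth_passed // swaps_rcons //
  nth_rcons lt_k.
Qed.

Lemma sweep_word_rcons v y P : sweep_word (rcons v y) P =
  rcons (sweep_word v P) (nth 0 (sweep_word (rcons v y) P) (size v)).
Proof.
elim: P => [|t A IH] /=; first by rewrite nth_rcons ltnn eqxx.
rewrite IH passed_rcons; congr rcons.
by rewrite nth_rcons size_passed size_sweep_word ltnn eqxx.
Qed.

Lemma kept_rcons v y t : kept (rcons v y) t =
  if swaps (rcons v y) t (size v) then set_nth 0 (kept v t) (size v) y else
    kept v t.
Proof.
case: ifP => sw; last first.
  apply: (@eq_from_nth _ 0); rewrite !size_kept // => k lt_k.
  rewrite !nth_kept // size_rcons ltnS.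
  have [lt|gt|->] := ltngtP k (size v).
  - by rewrite swaps_rcons // nth_rcons lt.
  - by [].
  - by rewrite sw.
have lt_v := swaps_size sw.
apply: (@eq_from_nth _ 0).
  by rewrite size_set_nth !size_kept; apply/esym/maxn_idPr.
move=> k; rewrite size_kept => lt_k; rewrite nth_set_nth /= !nth_kept //
  size_rcons ltnS.
have [lt|gt|->] := ltngtP k (size v).
- by rewrite swaps_rcons // nth_rcons lt.
- by [].
- by rewrite sw nth_rcons ltnn eqxx.
Qed.

Lemma idle_swaps v t k : idle v t -> k < size v -> swaps v t k = false.
Proof.
move=> id; elim: k => //= k IH lt_k; rewrite (IH (ltnW lt_k)).
apply/negP => /and3P[lt_t le1 _]; have := id k (ltnW lt_t) lt_k.
by rewrite ltnNge le1.
Qed.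

Lemma idle_passed v t : idle v t -> passed v t = v.
Proof.
move=> id; apply: (@eq_from_nth _ 0); first exact: size_passed.
by move=> k; rewrite size_passed => lt_k; rewrite nth_passed // idle_swaps.
Qed.

Lemma idle_kept v t : idle v t -> kept v t = t.
Proof.
move=> id; apply: (@eq_from_nth _ 0); first exact: size_kept.
move=> k; rewrite size_kept => lt_k; rewrite nth_kept //.
by case: ltnP => //= lt_v; rewrite idle_swaps.
Qed.

Lemma idle_rcons v y t : idle (rcons v y) t -> idle v t.
Proof.
move=> id k lt_t lt_v; have := id k lt_t.
by rewrite size_rcons nth_rcons lt_v; apply; exact: leqW.
Qed.

Lemma nonstop_rcons v y P : nonstop (rcons v y) P -> nonstop v P.
Proof.
elim: P => //= t A IH [H /IH ?]; split=> //; case: H.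
  by rewrite sweep_word_rcons => /idle_rcons; left.
by rewrite size_rcons => /ltnW; right.
Qed.

Lemma sorted_passed v t : sorted leq v -> sorted leq t ->
  idle v t \/ size v <= size t -> sorted leq (passed v t).
Proof.
move=> sv st [/idle_passed -> //|le_vt].
apply/(sortedP 0) => k; rewrite size_passed => lt_k.
rewrite !nth_passed ?(ltnW lt_k) //= (leq_trans lt_k le_vt) /=.
have lev : nth 0 v k <= nth 0 v k.+1 by apply: nth_sorted_leq.
have let_ : nth 0 t k <= nth 0 t k.+1.
  by apply: nth_sorted_leq => //; exact: leq_trans le_vt.
case sw: (swaps v t k); last by case: ifP; lia.
by have := swaps_lt sw; case: ifP; lia.
Qed.

Lemma sweep_word_sorted v P : sorted leq v -> all (sorted leq) P -> nonstop v P ->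
  sorted leq (sweep_word v P).
Proof.
move=> sv; elim: P => //= t A IH /andP[st sA] [H /(IH sA) sw].
by apply: sorted_passed => //; rewrite size_sweep_word.
Qed.

Lemma sweep_word_ge v P k : nth 0 v k <= nth 0 (sweep_word v P) k.
Proof.
have [lt_k|ge_k] := ltnP k (size v); last by rewrite nth_default.
elim: P => //= t A IH; rewrite nth_passed ?size_sweep_word //.
by case: ifP => // /swaps_lt/ltnW; exact: leq_trans.
Qed.

(** After the letters of [w], column [d] of the row holds exactly the value tested by [swaps] at
    [d.+1], and column [d.+1] is still that of [t]. The disjunction excludes a stop. *)
Lemma row_pass_kept d w y t : size w = d.+1 ->
  idle (rcons w y) t \/ d.+1 < size t ->
  row_pass d (Some y) (kept w t) =
    (Some (if swaps (rcons w y) t d.+1 then nth 0 t d.+1 else y),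
     kept (rcons w y) t).
Proof.
move=> szw H.
have keptd : d < size t -> nth 0 (kept w t) d =
    if swaps (rcons w y) t d then nth 0 (rcons w y) d else nth 0 t d.
  by move=> lt; rewrite nth_kept // swaps_rcons szw // ltnSn nth_rcons szw ltnSn.
have keptd1 : nth 0 (kept w t) d.+1 = nth 0 t d.+1.
  have [lt|ge] := ltnP d.+1 (size t); first by rewrite nth_kept // szw ltnn.
  by rewrite !nth_default ?size_kept.
rewrite kept_rcons szw [swaps _ _ d.+1]/= [nth 0 _ d.+1]nth_rcons szw ltnn eqxx.
case: row_passP => [|lt le1 lt2|sz le1].
- rewrite size_kept keptd1 => Hi; case: and3P => // -[lt1 le1 lt2]; exfalso.
  rewrite (keptd (ltnW lt1)) in Hi; have [|_] := Hi _ le1; first exact: ltnW.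
  by rewrite leqNgt lt2.
- rewrite size_kept keptd1 in lt lt2 *.
  by rewrite (keptd (ltnW lt)) in le1; rewrite lt le1 lt2.
- exfalso; rewrite size_kept in sz; rewrite keptd ?sz // in le1; case: H;
    last by rewrite sz ltnn.
  move=> id; rewrite idle_swaps // ?size_rcons ?szw ?ltnS ?leqnSn // in le1.
  have := id d; rewrite sz size_rcons szw nth_rcons szw ltnn eqxx.
  by move=> /(_ (ltnSn _) (ltnSn _)); rewrite ltnNge le1.
Qed.

(* The sweep moves all letters through one row, the insertion one letter through
   all rows; both orders agree because row t at column k only depends on the
   letters 0, ..., k. *)
Lemma col_pass_sweep d v y P : size v = d.+1 -> nonstop (rcons v y) P ->
  col_pass d (Some y) (sweep_rows v P) =
    (Some (nth 0 (sweep_word (rcons v y) P) d.+1), sweep_rows (rcons v y) P).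
Proof.
move=> szv; elim: P => [|t A IH] /=.
  by rewrite nth_rcons szv ltnn eqxx.
case=> H /IH ->; have E := sweep_word_rcons v y A; rewrite szv in E.
set y' := nth 0 (sweep_word (rcons v y) A) d.+1 in E *.
rewrite E size_rcons szv in H *.
have szw : size (sweep_word v A) = d.+1 by rewrite size_sweep_word.
by rewrite (row_pass_kept szw H) passed_rcons nth_rcons size_passed szw ltnn eqxx.
Qed.

(** The critical case is a row ending in column [d]. If idleness failed at [k], the current entry in
    column [k] would be at most letter [k.+1], and this propagates to the right ([step]): letter
    [j.+1] either replaces the entry in column [j.+1] or is not below it, and it is at most letter
    [j.+2]. In column [d] this says that [y] would have extended the row. *)
Lemma row_pass_idle d w y t k1 t1 : size w = d.+1 -> sorted leq (rcons w y) ->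
  sorted leq t -> idle w t \/ size w <= size t ->
  row_pass d (Some y) (kept w t) = (Some k1, t1) ->
  idle (rcons w y) t \/ d.+1 < size t.
Proof.
move=> szw sw st H E; have [lt|le] := ltnP d.+1 (size t); [by right|left].
have [ltd|led] := ltnP d (size t); last first.
  case: H => [id|]; last by rewrite szw leqNgt ltnS led.
  move=> k lt_k _; have := id k lt_k; rewrite szw nth_rcons szw !ltnS.
  by move=> H; have lt_kd := leq_trans lt_k led; rewrite lt_kd; exact: H.
have szt : size t = d.+1 by apply/eqP; rewrite eqn_leq le ltd.
pose cur j := if swaps (rcons w y) t j then nth 0 (rcons w y) j else nth 0 t j.
have curd : y < cur d.
  rewrite /cur swaps_rcons ?szw // nth_rcons szw ltnSn.
  have -> : (if swaps w t d then nth 0 w d else nth 0 t d) = nth 0 (kept w t) d.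
    by rewrite nth_kept // szw ltnSn.
  rewrite ltnNge; apply/negP => le1; move: E;
    rewrite /row_pass size_kept ltd le1 /=.
  by rewrite szt ltnn.
move=> k lt_k _; rewrite ltnNge; apply/negP => le_k.
have step j : k <= j -> j <= d -> cur j <= nth 0 (rcons w y) j.+1.
  elim: j => [|j IH] le_kj le_jd.
    by rewrite /cur /=; move: le_kj le_k; rewrite leqn0 => /eqP ->.
  have le_next : nth 0 (rcons w y) j.+1 <= nth 0 (rcons w y) j.+2.
    by apply: nth_sorted_leq => //; rewrite size_rcons szw ltnS.
  have [ek|nek] := eqVneq k j.+1.
    rewrite /cur; case: ifP => // _; by rewrite -ek.
  have {}IH : cur j <= nth 0 (rcons w y) j.+1 by apply: IH; lia.
  rewrite {1}/cur; case: ifP => // /negbT;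
    rewrite /= -/(cur j) IH szt ltnS le_jd /= -leqNgt.
  by move=> le2; exact: leq_trans le_next.
have lastE : nth 0 (rcons w y) d.+1 = y by rewrite nth_rcons szw ltnn eqxx.
have le_kd : k <= d by rewrite -ltnS -szt.
by have := step d le_kd (leqnn d); rewrite lastE leqNgt curd.
Qed.

Lemma nonstop_of_col_pass d v y P k1 P1 : size v = d.+1 ->
  sorted leq (rcons v y) -> all (sorted leq) P -> nonstop v P ->
  col_pass d (Some y) (sweep_rows v P) = (Some k1, P1) -> nonstop (rcons v y) P.
Proof.
move=> szv sv; elim: P k1 P1 => //= t A IH k1 P1 /andP[st sA] [H nsA].
case E: col_pass => [[k|] A1] //; case E2: row_pass => [s2 t1] [es _].
rewrite {}es in E2; have ns := IH _ _ sA nsA E; split=> //.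
move: E; rewrite (col_pass_sweep szv ns) => -[ek _].
have sw := sweep_word_sorted sv sA ns; move: sw.
rewrite sweep_word_rcons szv ek size_rcons szv => sw.
by apply: (row_pass_idle _ sw st _ E2); rewrite size_sweep_word.
Qed.

Lemma sweep_short v P : size v <= 1 -> sweep_word v P = v /\ sweep_rows v P = P.
Proof.
move=> le1; have id t : idle v t by move=> k _ /leq_trans/(_ le1).
by elim: P => //= t A [-> ->]; rewrite idle_passed // idle_kept.
Qed.

Lemma nth_sweep_rows v P i k : size v <= k ->
  nth 0 (nth [::] (sweep_rows v P) i) k = nth 0 (nth [::] P i) k.
Proof.
move=> le_k; elim: P i => [|t A IH] [|i] //=.
have [lt|ge] := ltnP k (size t); last by rewrite !nth_default ?size_kept.
by rewrite nth_kept // size_sweep_word ltnNge le_k.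
Qed.

Lemma size_nth_sweep_rows v P i :
  size (nth [::] (sweep_rows v P) i) = size (nth [::] P i).
Proof. by rewrite !nth_shape_size shape_sweep_rows. Qed.

(** The earlier letters have left columns from [d.+1] on as in [P], where [y] is below every entry;
    so the passes there do nothing. *)
Lemma insert_sweep_run d v y P : size v = d.+1 ->
  all (sorted leq) (sweep_word v P :: sweep_rows v P) ->
  (forall t, t \in P -> d.+1 < size t -> y < nth 0 t d.+1) ->
  insert y (sweep_word v P :: sweep_rows v P) =
  let: (T', (k', c)) := run d.+1 y (sweep_word v P :: sweep_rows v P) in
  if c == 0 then (add_row T' k', 0) else (T', c).
Proof.
move=> szv sT lt_y; set T := _ :: _; set n := maxn (colmax T) d.+1.
rewrite (@insert_colmax T y n) ?leq_maxl // (run_pass sT (d := d.+1)) ?leq_maxr //.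
move=> t; rewrite inE => /orP[/eqP ->|]; first by rewrite size_sweep_word szv ltnn.
move=> /(nthP [::])[i lt_i <-]; rewrite size_nth_sweep_rows nth_sweep_rows ?szv //.
by move=> lt_d; apply: lt_y (lt_d); exact: mem_nth_row lt_d.
Qed.

Lemma insert_sweep d v y P : size v = d.+1 -> sorted leq (rcons v y) ->
  all (sorted leq) P -> all (sorted leq) (sweep_rows v P) ->
  nonstop (rcons v y) P ->
  (forall t, t \in P -> d.+1 < size t -> y < nth 0 t d.+1) ->
  insert y (sweep_word v P :: sweep_rows v P) =
    (sweep_word (rcons v y) P :: sweep_rows (rcons v y) P, d.+1).
Proof.
move=> szv sv sP sQ ns lt_y.
have svv : sorted leq v by move: sv; rewrite -cats1 => /cat_sorted2[].
rewrite (insert_sweep_run szv _ lt_y); last first.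
  by rewrite /= sQ sweep_word_sorted //; exact: nonstop_rcons ns.
rewrite /= (col_pass_sweep szv ns) /=.
have E := sweep_word_rcons v y P; rewrite szv in E.
have := sweep_word_sorted sv sP ns.
set y' := nth 0 (sweep_word (rcons v y) P) d.+1 in E *.
rewrite E; set e := sweep_word v P => se.
have sze : size e = d.+1 by rewrite size_sweep_word.
have -> : row_pass d (Some y') e = (None, rcons e y'); last by [].
have le_y : nth 0 e d <= y'.
  have := @nth_sorted_leq _ d d.+1 se (leqnSn d).
  by rewrite size_rcons sze => /(_ (ltnSn _));
    rewrite !nth_rcons sze ltnn eqxx ltnSn.
by rewrite /row_pass sze ltnSn le_y /= ltnn.
Qed.

(** * Insertion of a whole row *)


Definition heads (P : filling) : seq nat := [seq nth 0 t 0 | t <- P].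

(** What increasing columns and SE-decrease demand of a row [r] placed below the rows of [P]. Only
    the values in each column among the rows of each length matter, so the condition can be
    transferred between a filling and its insertion tableau. *)
Definition stackable (r : seq nat) (P : filling) : Prop :=
  [/\ sorted ltn r,
      forall t k, t \in P -> k < size t -> k < size r -> nth 0 r k < nth 0 t k
    & forall t k, t \in P -> size t < size r -> k < size t ->
        nth 0 r k.+1 < nth 0 t k].

(** The local form of the shuffle hypothesis: a part other than 1 bounds all later parts, whereas a
    1 may precede anything. *)
Definition dominates (m : nat) (s : seq nat) : bool := (m == 1) || all (leq^~ m) s.

Fixpoint good_shape (a : seq nat) : bool :=
  if a is m :: b then dominates m b && good_shape b else true.

Lemma sweep_word_idle r A : (forall t, t \in A -> idle r t) -> sweep_word r A = r.
Proof.
elim: A => //= t A IH H; rewrite IH; last by move=> u uA; apply: H;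
  rewrite inE uA orbT.
by apply: idle_passed; apply: H; rewrite mem_head.
Qed.

Lemma sweep_word_second r A :
  (forall t, t \in A -> nth 0 r 1 < nth 0 t 0) ->
  nth 0 (sweep_word r A) 1 = nth 0 r 1.
Proof.
have [lt1|ge1] := ltnP 1 (size r); last by rewrite !nth_default ?size_sweep_word.
elim: A => //= t A IH H; rewrite nth_passed ?size_sweep_word //= IH; last first.
  by move=> u uA; apply: H; rewrite inE uA orbT.
by rewrite [X in _ && (X && _)]leqNgt H ?mem_head // andbF.
Qed.

(** Let [t] be shorter than [r]. If [t] has length other than 1, the rows above it are no longer
    than [t], hence idle, and [r] reaches [t] unchanged. If [t] has length 1, longer rows above may
    change the word, but only its letter 1 matters; that letter is below the head of [t], hence
    below all heads above, and never swaps. *)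
Lemma nonstop_of_stackable r P : all (leq 1) (shape P) -> good_shape (shape P) ->
  sorted ltn (heads P) -> dominates (size r) (shape P) -> stackable r P ->
  nonstop r P.
Proof.
move=> pos gP sh dom [_ _ H]; elim: P pos gP sh dom H => //= t A IH.
move=> /andP[post posA] /andP[domt gA] sh dom H.
have HA : forall u, u \in A -> u \in t :: A by move=> u uA; rewrite inE uA orbT.
split; last first.
  apply: IH posA gA (path_sorted sh) _ _.
    by move: dom; rewrite /dominates /= => /orP[->|/andP[_ ->]]; rewrite ?orbT.
  by move=> u k uA; apply: H; exact: HA.
have [le|lt] := leqP (size r) (size t); [by right|left].
have [sz1|szn1] := eqVneq (size t) 1; last first.
  rewrite sweep_word_idle => [k lt_k _|u uA k lt_k _]; apply: H => //.
  - exact: mem_head.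
  - exact: HA.
  - move: domt; rewrite /dominates (negbTE szn1) /= => /allP/(_ (size u)).
    by move=> le_u; apply: leq_ltn_trans lt; apply: le_u; exact: map_f.
move=> k; rewrite sz1 ltnS leqn0 => /eqP -> _.
have lt1 : nth 0 r 1 < nth 0 t 0 by apply: H; rewrite ?mem_head // sz1.
rewrite sweep_word_second // => u uA; apply: ltn_trans lt1 _.
have /allP Hmin := order_path_min ltn_trans sh.
exact: (Hmin _ (map_f (nth 0 ^~ 0) uA)).
Qed.

Lemma insert_word_sweep r P : all (leq 1) (shape P) -> all (sorted leq) P ->
  sorted leq r -> 0 < size r -> nonstop r P ->
  (forall t k, t \in P -> k < size t -> k < size r -> nth 0 r k < nth 0 t k) ->
  insert_word P r = sweep_word r P :: sweep_rows r P /\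
  new_cols P r = iota 0 (size r).
Proof.
move=> pos sP; elim/last_ind: r => // v y IH sv _ ns H.
have Hy t : t \in P -> size v < size t -> y < nth 0 t (size v).
  by move=> tP lt; have := H t (size v) tP lt;
    rewrite size_rcons ltnSn nth_rcons ltnn eqxx; apply.
case: (posnP (size v)) => [/size0nil v0|].
  rewrite v0 in Hy * => {IH sv ns H}.
  have [-> ->] := @sweep_short [:: y] P isT.
  rewrite /= insert_min // => t tP.
  have pt : 0 < size t by apply: (allP pos); exact: map_f.
  by split=> //; exact: Hy.
move=> sz; have [||eP ec] := IH _ sz (nonstop_rcons ns).
- by move: sv; rewrite -cats1 => /cat_sorted2[].
- move=> t k tP lt_t lt_k; have := H t k tP lt_t.
  by rewrite size_rcons nth_rcons lt_k (ltn_trans lt_k) //; apply.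
have := insert_word_sorted v sP; rewrite eP => /= /andP[_ sQ].
have [d szv] : exists d, size v = d.+1 by exists (size v).-1; rewrite prednK.
rewrite szv in Hy.
have ins := insert_sweep szv sv sP sQ ns Hy.
have iotaS : iota 0 d.+2 = iota 0 d.+1 ++ [:: d.+1] by rewrite -[d.+2]addn1 iotaD.
by rewrite -cats1 insert_word_cat new_cols_cat eP ec /= cats1 ins size_rcons
  szv iotaS.
Qed.

(** Exchanging entries of one column between rows of equal length changes the rows but none of these
    sets. *)
Definition same_colsets (P T : filling) : Prop :=
  forall L k, k < L ->
    [seq nth 0 t k | t <- P & size t == L] =i [seq nth 0 t k | t <- T & size t
      == L].

Lemma same_colsets_sym P T : same_colsets P T -> same_colsets T P.
Proof. by move=> H L k lt x; rewrite H. Qed.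

Lemma stackable_colsets r P T : same_colsets P T -> stackable r P -> stackable r T.
Proof.
move=> H [sr H1 H2]; have tr t k : t \in T -> k < size t ->
    exists t', [/\ t' \in P, size t' = size t & nth 0 t' k = nth 0 t k].
  move=> tT lt_k; have := H (size t) k lt_k (nth 0 t k).
  rewrite [X in _ = X]map_f ?mem_filter ?eqxx // => /mapP[t'].
  by rewrite mem_filter => /andP[/eqP sz t'P] e; exists t'.
split=> // t k tT; first by move=> lt_k lt_r;
  have [t' [t'P sz <-]] := tr t k tT lt_k; apply: H1; rewrite ?sz.
by move=> lt_s lt_k; have [t' [t'P sz <-]] := tr t k tT lt_k; apply: H2;
  rewrite ?sz.
Qed.

(** A row that is not idle has exactly the length of [r], so each swap exchanges entries of one
    column between rows of equal length. *)
Lemma sweep_colsets r P : (forall t, t \in P -> size t <= size r) -> nonstop r P ->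
  same_colsets (sweep_word r P :: sweep_rows r P) (r :: P).
Proof.
move=> le_r ns L k lt_k x; elim: P le_r ns => //= t A IH le_r [H /IH{}IH].
have {}IH := IH (fun u uA => le_r u (mem_behead (uA : u \in behead (t :: A)))).
rewrite size_passed size_sweep_word size_kept in IH *; move: IH.
case: H => [id|le_rt].
  rewrite idle_passed // idle_kept //; case: (size r == L);
    case: (size t == L) => //=.
    by rewrite !inE => IH; rewrite orbCA IH; exact: orbCA.
  by rewrite !inE => ->.
have <- : size r = size t by apply/eqP; rewrite eqn_leq le_rt le_r ?mem_head.
case: eqP => //= eL; rewrite !inE => IH.
rewrite [RHS]orbCA -IH nth_passed ?size_sweep_word ?eL // nth_kept
  ?size_sweep_word ?eL //; last first.
  by rewrite (leq_trans lt_k) // -eL.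
by rewrite lt_k /=; case: ifP => _ //; exact: orbCA.
Qed.

Lemma heads_sweep_rows v P : heads (sweep_rows v P) = heads P.
Proof.
rewrite /heads; elim: P => //= t A ->; congr cons.
by case: t => [|x t] //; rewrite nth_kept // andbF.
Qed.

Lemma sweep_word_head v P : nth 0 (sweep_word v P) 0 = nth 0 v 0.
Proof.
by elim: P => //= t A <-; case: (sweep_word v A).
Qed.


(** * From the columns of the new cells back to the inequalities *)

(** Induction on the letters [s] still to come, the letters of [v] having swept [P] already;
    [nonstop] is extended by one letter at a time. *)
Lemma nonstop_of_new_cols s v P :
  0 < size v -> sorted ltn (v ++ s) -> all (sorted leq) P -> nonstop v P ->
  all (sorted leq) (sweep_rows v P) ->
  new_cols (sweep_word v P :: sweep_rows v P) s = iota (size v) (size s) ->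
  shape (insert_word (sweep_word v P :: sweep_rows v P) s) =
    size (v ++ s) :: shape P ->
  all (leq^~ (size (v ++ s))) (shape P) ->
  nonstop (v ++ s) P /\
  forall t k, t \in P -> size v <= k < size (v ++ s) -> k < size t ->
    nth 0 (v ++ s) k < nth 0 t k.
Proof.
elim: s v => [|y s IH] v; first by rewrite cats0 => *; split=> // t k; lia.
move=> v0 sv sP ns sQ cols sh le_sh; set T := _ :: _ in cols sh.
have [d szv] : exists d, size v = d.+1 by exists (size v).-1; rewrite prednK.
have slv : sorted leq (rcons v y).
  move: sv; rewrite -cat_rcons => /cat_sorted2[sv _]; apply: sub_sorted sv.
  by move=> i j; exact: ltnW.
have sT : all (sorted leq) T.
  rewrite /= sQ sweep_word_sorted //.
  by move: slv; rewrite -cats1 => /cat_sorted2[].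
have lt_y t : t \in P -> d.+1 < size t -> y < nth 0 t d.+1.
  (* Otherwise [y] lands beyond column [d.+1] and the later letters further still, which yields a
     row longer than [v ++ s]. *)
  move=> /(nthP [::])[i lt_i <-] lt_d; rewrite ltnNge; apply/negP => le_y.
  have sys : sorted ltn (y :: s) by case/cat_sorted2: sv.
  have mem_i : nth [::] (sweep_rows v P) i \in T.
    rewrite inE (@mem_nth_row _ i d) ?orbT // size_nth_sweep_rows; exact: ltnW.
  have [||t2 t2T lt_t2] := @insert_word_long_row T y s _ d.+1 sT sys mem_i.
  - by rewrite size_nth_sweep_rows.
  - by rewrite nth_sweep_rows // szv.
  have : size t2 \in shape (insert_word T (y :: s)) by exact: map_f.
  rewrite sh inE size_cat szv => /orP[/eqP e|/(allP le_sh)];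
    first by rewrite e ltnn in lt_t2.
  by rewrite size_cat szv leqNgt lt_t2.
have insE := insert_sweep_run szv sT lt_y.
move: insE => /=; case E: col_pass => [[k1|] Q1]; last first.
  (* The letter has extended a row of [P]. Later letters start no new row, so rows keep their
     positions, and this one is too long in the final shape. *)
  move=> insE; exfalso; rewrite -/T in insE.
  have [A [B [eA eB]]] := col_pass_shape_None E.
  rewrite shape_sweep_rows in eA.
  move: cols sh; rewrite /= insE /= => -[_ cols] sh.
  have [|_] := @insert_word_shape_le (sweep_word v P :: Q1) s.
    by rewrite cols; apply/allP => i; rewrite mem_iota; lia.
  rewrite sh /= eA eB => /(_ (size A).+1) /=.
  by rewrite !nth_cat !ltnn !subnn /= ltnn.
move=> _; have nsy := nonstop_of_col_pass szv slv sP ns E.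
have ins := insert_sweep szv slv sP sQ nsy lt_y.
move: cols sh; rewrite [new_cols _ _]/= [insert_word _ _]/= -/T in ins *;
  rewrite ins /=.
move=> [_ cols] sh; rewrite szv in cols; have sQy : all (sorted leq)
  (sweep_rows (rcons v y) P).
  by have := insert_sorted y sT; rewrite ins => /andP[].
have [|||||nsf H] := IH (rcons v y) _ _ sP nsy sQy;
  rewrite ?cat_rcons ?size_rcons ?szv //.
split; first by rewrite -cat_rcons.
move=> t k tP /andP[le_k lt_k] lt_t; have [ek|nek] := eqVneq k d.+1.
  by rewrite ek in lt_t *; rewrite nth_cat szv ltnn subnn; exact: lt_y.
by rewrite -cat_rcons; apply: H => //; rewrite cat_rcons size_rcons szv lt_k; lia.
Qed.

Lemma row_pass_head d s r : nth 0 (row_pass d s r).2 0 = nth 0 r 0.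
Proof.
case: s => [k|] //; case: row_passP => [|lt _ _|sz _] //=;
  first by rewrite nth_set_nth.
by rewrite nth_rcons sz.
Qed.

Lemma col_pass_heads d s T : heads (col_pass d s T).2 = heads T.
Proof.
elim: T => //= t T; case: (col_pass d s T) => s1 T1 /= <-.
by have := row_pass_head d s1 t; case: row_pass => s2 t2 /= ->.
Qed.

Lemma run_heads n k T : heads (run n k T).1 = heads T.
Proof.
elim: n k T => //= d IH k T; have := col_pass_heads d (Some k) T.
by case: col_pass => [[k'|] T'] //= <-.
Qed.

(* The bottom left cell is processed last, so a row of length 1 at the bottom
   must exceed the entry that starts a new row. *)
Lemma run_bottom n k t A T1 k1 : run n.+1 k (t :: A) = (T1, (k1, 0)) ->
  size (head [::] T1) = 1 -> k1 < nth 0 (head [::] T1) 0.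
Proof.
elim: n k t A => [|n IH] k t A.
  rewrite /=; case: col_pass => [[k'|] A']; last by rewrite /row_pass.
  case: row_passP => [idle|lt _ _|//] [<- <-] /=.
    by move=> sz; rewrite ltnNge; apply/negP => le1; have [] := idle _ le1;
      rewrite sz.
  by rewrite size_set_nth (maxn_idPr lt) => e; rewrite e in lt.
rewrite [run _ _ _]/=; case: (col_pass n.+1 (Some k) A) => [[k'|] A']; last by [].
by case: row_pass => [[k2|] t2] // /IH.
Qed.

(** The shape alone does not tell which row of length 1 is new. If it were not the lowest, the
    bottom row would have length 1 and a head at most the entry starting the new row, against
    [run_bottom]. *)
Lemma insert_new_bottom x P T1 b : all (leq 1) (shape P) ->
  insert x P = (T1, 0) -> shape T1 = 1 :: b ->
  shape P = b /\ (P != [::] -> x < head 0 (heads P)).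
Proof.
(* The successor provides the pass that [run_bottom] requires. *)
move=> pos; set n := (colmax P).+1.
rewrite (@insert_colmax P x n) //; case E: run => [T' [k1 c]].
case: eqP => [c0 [eT1] sh|nc0 [_ c1]]; last by case: nc0.
rewrite {}c0 in E.
have shT' : shape T' = shape P by have := run_shape E.
have hT' : heads T' = heads P by have := run_heads n x P; rewrite E.
have [A [B [eT' eA hA hB]]] := add_row_cat T' k1.
case: A eA eT' hA => [|a A] /= eA eT' hA; last first.
  exfalso; case/andP: hA => le_a _.
  case: P @n E shT' {pos hT'} => [|t P] n E shT'; first by rewrite eT' in shT'.
  have := run_bottom E; rewrite eT' /= -nth0 in le_a *.
  rewrite -eT1 eA in sh; case: sh => sz _.
  by rewrite ltnNge le_a => /(_ sz).
rewrite -eT1 eA in sh; case: sh => sh; split; first by rewrite -shT' eT'.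
rewrite -hT' eT' => nP; have nB : B != [::].
  by apply: contra nP => /eqP B0; rewrite -size_eq0 -(size_map size) -[map _
    _]/(shape P) -shT' eT' B0.
have := hB nB; case: (B) nB => //= u B' _; rewrite nth0; apply: leq_ltn_trans.
exact: run_le E.
Qed.

Lemma shape_le_eq s s' : shape_le s s' -> sumn s = sumn s' -> s = s'.
Proof.
elim: s s' => [|x s IH] [|y s'] [] //= [sz] le.
have le0 := le 0; have les : shape_le s s' by split=> // i; exact: (le i.+1).
have le_sum : sumn s <= sumn s'.
  move: sz (les.2); elim: (s) (s') => [|u w IHw] [|u' w'] //= [sz] H.
  by apply: leq_add; [exact: (H 0)|apply: IHw => // i; exact: (H i.+1)].
move=> /= e; have exy : x = y by rewrite /= in le0; lia.
by rewrite exy (IH s') //; lia.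
Qed.

Lemma size_flatten_shape (T : filling) : size (flatten T) = sumn (shape T).
Proof. exact: size_flatten. Qed.

Lemma sorted_leq_of_ltn (s : seq nat) : sorted ltn s -> sorted leq s.
Proof. by apply: sub_sorted => i j; exact: ltnW. Qed.

(** If [r] has at least two letters, its first one is below every head, as otherwise a row longer
    than [r] would arise; so it starts the bottom row. Afterwards rows only grow, and comparing
    numbers of cells shows that those of [P] do not. *)
Lemma block_shape r P b : all (leq 1) (shape P) -> all (sorted leq) P ->
  uniq (r ++ flatten P) -> 0 < size r -> new_cols P r = iota 0 (size r) ->
  shape (insert_word P r) = size r :: b -> dominates (size r) b ->
  shape P = b /\ (1 < size r -> forall t, t \in P -> nth 0 r 0 < nth 0 t 0).
Proof.
case: r => // x r pos sP uP _ cols sh dom.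
have sr := sorted_of_new_cols uP cols.
case: r cols sh dom sr uP => [|x2 r] cols sh dom sr uP.
  split=> //; move: cols sh => /=; case E: (insert x P) => [T1 c] /= [c0] sh.
  by rewrite c0 in E; have [] := insert_new_bottom pos E sh.
have ltx t : t \in P -> x < nth 0 t 0.
  move=> tP; rewrite ltnNge; apply/negP => le_x.
  have pt : 0 < size t by apply: (allP pos); exact: map_f.
  have [t' t'T] := insert_word_long_row sP sr tP pt le_x; rewrite add0n ltnNge.
  have : size t' \in shape (insert_word P [:: x, x2 & r]) by exact: map_f.
  rewrite sh inE => /orP[/eqP ->|t'b]; first by rewrite leqnn.
  by move: dom; rewrite /dominates /= => /allP/(_ _ t'b) ->.
split=> //; have ins : insert x P = ([:: x] :: P, 0).
  apply: insert_min => // t tP; split; last exact: ltx.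
  by apply: (allP pos); exact: map_f.
have eW : insert_word P [:: x, x2 & r] = insert_word ([:: x] :: P) (x2 :: r).
  by rewrite [LHS]/= ins.
have [|sz le] := @insert_word_shape_le ([:: x] :: P) (x2 :: r).
  move: cols; rewrite [new_cols _ _]/= ins => -[c1 c2]; rewrite /= c1 c2.
  by apply/allP => i; rewrite mem_iota; lia.
rewrite -eW sh in sz le; apply: shape_le_eq.
  by split; [case: sz | move=> i; exact: (le i.+1)].
have := perm_size (insert_word_perm P [:: x, x2 & r]).
by rewrite size_cat !size_flatten_shape sh /= => /eqP; rewrite eqn_add2l => /eqP.
Qed.

Lemma stackable_of_new_cols r P : all (leq 1) (shape P) -> all (sorted leq) P ->
  sorted ltn (heads P) -> uniq (r ++ flatten P) -> 0 < size r ->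
  new_cols P r = iota 0 (size r) -> shape (insert_word P r) = size r :: shape P ->
  dominates (size r) (shape P) -> stackable r P.
Proof.
move=> pos sP sh uP r0 cols shr dom.
have sr := sorted_of_new_cols uP cols.
have [_ Hx] := block_shape pos sP uP r0 cols shr dom.
have ltx t : t \in P -> nth 0 r 0 < nth 0 t 0.
  move=> tP; have [/Hx|le1] := ltnP 1 (size r); first exact.
  case: r r0 le1 cols shr {uP dom sr Hx} => // x [|//] _ _ /= cols shr.
  case E: (insert x P) cols shr => [T1 c] /= [c0] shr; rewrite c0 in E.
  have [_] := insert_new_bottom pos E shr; case: (P) tP sh => // u A tA /= sh.
  move=> /(_ isT) lt_x; move: tA; rewrite inE => /orP[/eqP -> //|tA].
  apply: ltn_trans lt_x _; have /allP Hmin := order_path_min ltn_trans sh.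
  exact: (Hmin _ (map_f (nth 0 ^~ 0) tA)).
case: r r0 uP cols shr dom sr ltx {Hx} => // x r _ uP cols shr dom sr ltx.
have ins : insert x P = ([:: x] :: P, 0).
  apply: insert_min => // t tP; split; last exact: ltx.
  by apply: (allP pos); exact: map_f.
have [sw1 sr1] := @sweep_short [:: x] P isT.
have ns1 : nonstop [:: x] P.
  elim: (P) => //= t A IH; split=> //; left=> k _; by rewrite size_sweep_word.
have [sz1|lt1] := leqP (size (x :: r)) 1.
  split=> // t k tP lt_t lt_k; last by have := allP pos (size t) (map_f _ tP); lia.
  by have -> : k = 0; [lia|exact: ltx].
have le_sh : all (leq^~ (size ([:: x] ++ r))) (shape P).
  by move: dom; rewrite /dominates gtn_eqF.
have [|||ns H] := @nonstop_of_new_cols r [:: x] P isT sr sP ns1 _ _ _ le_sh;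
  rewrite ?sw1 ?sr1 //.
- by move: cols; rewrite /= ins => -[].
- by move: shr; rewrite [insert_word _ _]/= ins.
rewrite cat1s in ns; split=> // t k tP.
  move=> lt_t lt_k; case: k lt_t lt_k => [|k] lt_t lt_k; first exact: ltx.
  exact: H.
move=> lt_s lt_k.
(* A short row is idle for the word that reaches it, whose letters are at least those of
   [x :: r]. *)
elim: (P) tP ns => //= u A IH; rewrite inE => /orP[/eqP <-|tA] [Hu nsA];
  last exact: IH.
case: Hu => [id|]; last by rewrite leqNgt lt_s.
apply: leq_ltn_trans (sweep_word_ge (x :: r) A k.+1) _; apply: id => //.
by rewrite size_sweep_word; exact: leq_trans lt_s.
Qed.

(** * Insertion of all rows *)


Fixpoint stack_tableau (T : filling) : Prop :=
  if T is r :: T0 then stackable r T0 /\ stack_tableau T0 else True.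

Fixpoint insert_rows (T : filling) : filling :=
  if T is r :: T0 then insert_word (insert_rows T0) r else [::].

Fixpoint row_cols (T : filling) : Prop :=
  if T is r :: T0 then
    new_cols (insert_rows T0) r = iota 0 (size r) /\ row_cols T0
  else True.

Lemma insert_pos x P : all (leq 1) (shape P) -> all (leq 1) (shape (insert x P).1).
Proof.
case E: (insert x P) => [T1 c] /=; have [A [B]] := insert_shape E.
by case: ifP => _ [-> ->]; rewrite !all_cat //= => /and3P[-> _ ->].
Qed.

Lemma insert_word_pos P r : all (leq 1) (shape P) -> all (leq 1) (shape
  (insert_word P r)).
Proof. by elim: r P => //= x r IH P posP; apply/IH/insert_pos. Qed.

Lemma insert_rows_pos T : all (leq 1) (shape (insert_rows T)).
Proof. by elim: T => //= r T; exact: insert_word_pos. Qed.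

Lemma insert_rows_sorted T : all (sorted leq) (insert_rows T).
Proof. by elim: T => //= r T; exact: insert_word_sorted. Qed.

Lemma insert_rows_perm T : perm_eq (flatten (insert_rows T)) (flatten T).
Proof.
elim: T => //= r T IH; apply: perm_trans (insert_word_perm _ _) _.
by rewrite perm_cat2l.
Qed.

(** The conclusions support each other in the induction: the column sets transfer [stackable] to the
    insertion tableau, and its shape and increasing heads give [nonstop] for the next row. *)
Lemma insert_rows_spec T : all (leq 1) (shape T) -> good_shape (shape T) ->
  stack_tableau T ->
  [/\ shape (insert_rows T) = shape T, same_colsets (insert_rows T) T,
      sorted ltn (heads (insert_rows T)) & row_cols T].
Proof.
elim: T => [|r T IH] //= /andP[posr posT] /andP[dom goodT] [stk /IH].
case/(_ posT goodT) => shP csP hdP rcP.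
have sP := insert_rows_sorted T; have posP := insert_rows_pos T.
set P := insert_rows T in shP csP hdP sP posP *.
have stkP : stackable r P := stackable_colsets (same_colsets_sym csP) stk.
have [sr ltP _] := stkP.
rewrite -shP in goodT dom.
have ns := nonstop_of_stackable posP goodT hdP dom stkP.
have [eP ec] := insert_word_sweep posP sP (sorted_leq_of_ltn sr) posr ns ltP.
rewrite eP; split=> //.
- by rewrite /= size_sweep_word shape_sweep_rows shP.
- have cs1 : same_colsets (sweep_word r P :: sweep_rows r P) (r :: P).
    (* For length 1, [dominates] gives no bound on the rows above, but a single letter sweeps
       without any change. *)
    have [szr1|szr1] := eqVneq (size r) 1.
      by have [|-> ->] := @sweep_short r P; rewrite ?szr1.
    apply: sweep_colsets ns => t tP; move: dom; rewrite /dominates (negbTE szr1) /=.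
    by move=> /allP; apply; exact: map_f.
  move=> L k lt_k x; rewrite cs1 //=; case: ifP => _ /=; last exact: csP.
  by rewrite !inE csP.
- rewrite /= sweep_word_head heads_sweep_rows.
  case: (P) hdP ltP posP => //= t A hd ltP /andP[post _].
  by rewrite hd ltP ?mem_head.
Qed.

(** The bottom row is removed first: [block_shape] recovers the shape before its insertion, so the
    induction hypothesis applies to the rows above, and [insert_rows_spec] then describes their
    tableau. *)
Lemma stack_tableau_of_insert T : all (leq 1) (shape T) -> good_shape (shape T) ->
  uniq (flatten T) -> row_cols T -> shape (insert_rows T) = shape T ->
  stack_tableau T.
Proof.
elim: T => [|r T IH] //= /andP[posr posT] /andP[dom goodT] uT [cols rcT] sh.
have sP := insert_rows_sorted T; have posP := insert_rows_pos T.
have uP : uniq (r ++ flatten (insert_rows T)).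
  by rewrite (perm_uniq (_ : perm_eq _ (r ++ flatten T))) // perm_cat2l
    insert_rows_perm.
have [shP _] := block_shape posP sP uP posr cols sh dom.
have stkT : stack_tableau T.
  by apply: IH => //; move: uT; rewrite cat_uniq => /and3P[].
split=> //; have [_ csP hdP _] := insert_rows_spec posT goodT stkT.
apply: stackable_colsets csP _; rewrite -shP in dom sh.
exact: stackable_of_new_cols.
Qed.

Lemma insert_rows_word T : insert_word [::] (flatten (rev T)) = insert_rows T.
Proof.
elim: T => //= r T <-; rewrite rev_cons flatten_rcons.
exact: insert_word_cat.
Qed.

Definition block_cols (a : seq nat) : seq nat := flatten [seq iota 0 m | m <- a].

Lemma row_cols_word T :
  new_cols [::] (flatten (rev T)) = block_cols (rev (shape T)) <-> row_cols T.
Proof.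
elim: T => //= r T IH.
rewrite !rev_cons flatten_rcons /block_cols map_rcons flatten_rcons new_cols_cat.
rewrite insert_rows_word; split=> [/eqP|[-> /IH ->] //].
rewrite eqseq_cat => [/andP[/eqP/IH ? /eqP]|] //.
rewrite size_new_cols !size_flatten /shape map_rev sumn_rev -map_rev -[map size
  (rev T)]/(shape (rev T)).
by rewrite -!map_comp (eq_map (g := size)) ?map_rev ?sumn_rev // => m /=;
  rewrite size_iota.
Qed.

Lemma stack_tableauP T : stack_tableau T <->
  [/\ all (sorted ltn) T, columns_increase T & SE_decreasing (shape T) T].
Proof.
have memT (U : filling) t : t \in U -> exists2 i, i < size U & nth [::] U i = t.
  by move=> /(nthP [::])[i]; exists i.
elim: T => [|r T IH] /=.
  split=> // _; split=> // [i i' j _|i j /andP[_]] //.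
  by rewrite /is_cell /frow nth_nil.
split.
  case=> -[sr H1 H2] /IH[sT cT seT]; split; first by rewrite sr.
    move=> [|i] [|i'] j // lt_i; last exact: cT.
    by rewrite /is_cell /entry /frow /= => lt_r lt_t; apply: H1 => //;
      exact: mem_nth_row lt_t.
  move=> [|i] [|j] // /andP[lt_ij lt_j] /=; last first.
    by move=> lt_s k lt_k; apply: (seT i j) => //; rewrite -ltnS lt_ij.
  rewrite -nth_shape_size => lt_s k lt_k; apply: H2 => //.
  exact: mem_nth_row lt_k.
case=> /andP[sr sT] cT seT; split.
  split=> // t k /memT[i lt_i <-]; first by move=> lt_t lt_r; exact: (cT 0 i.+1 k).
  move=> lt_s lt_k; apply: (seT 0 i.+1) => /=; rewrite -?nth_shape_size //.
  by rewrite size_map ltnS.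
apply/IH; split=> // [i i' j lt_i|i j /andP[lt_ij lt_j] lt_s k lt_k];
  first exact: (cT i.+1 i'.+1 j).
by apply: (seT i.+1 j.+1) => //=; rewrite ltnS lt_ij.
Qed.

(** * The recording filling *)


Fixpoint record_cols (Q : filling) (k : nat) (cs : seq nat) : filling :=
  if cs is c :: cs' then record_cols (record_cell Q k c) k.+1 cs' else Q.

(* Excludes the junk value of [last 0 [::]] in [record_cell]. *)
Fixpoint recordable (Q : filling) (k : nat) (cs : seq nat) : Prop :=
  if cs is c :: cs' then
    (c = 0 \/ c \in shape Q) /\ recordable (record_cell Q k c) k.+1 cs'
  else True.

Lemma PQ_word_cols w P Q k :
  foldl PQ_step (P, Q) (zip w (iota k (size w))) =
  (insert_word P w, record_cols Q k (new_cols P w)).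
Proof.
elim: w P Q k => //= x w IH P Q k.
by rewrite /PQ_step /=; case: insert => P' c /=; exact: IH.
Qed.

Lemma record_cell_row Q k c : 0 < c -> c \in shape Q ->
  exists A r B, [/\ Q = A ++ r :: B, size r = c
    & record_cell Q k c = A ++ rcons r k :: B].
Proof.
move=> c0 /mapP[r0 r0Q sz0]; rewrite /record_cell gtn_eqF //.
set s := [seq i <- _ | _]; set i := last 0 s.
have : i \in s.
  have : index r0 Q \in s.
    by rewrite mem_filter mem_iota /frow nth_index // -sz0 eqxx /= index_mem.
  by rewrite /i; case: (s) => //= a l _; exact: mem_last.
rewrite mem_filter mem_iota /= => /andP[/eqP sz lt_i].
exists (take i Q), (frow Q i), (drop i.+1 Q); split=> //.
  by rewrite -drop_nth // cat_take_drop.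
by rewrite /set_entry set_nthE lt_i -{1}sz set_nth_size.
Qed.

(** When the entries of [Q] are distinct, this determines [c] from [k], so the columns of the new
    cells can be read off [Q]. *)
Definition recorded (Q : filling) (k c : nat) : Prop :=
  exists2 r, r \in Q & c < size r /\ nth 0 r c = k.

Lemma recorded_cell Q k c : c = 0 \/ c \in shape Q -> recorded (record_cell Q k
  c) k c.
Proof.
move=> H; have [->|] := posnP c.
  rewrite /record_cell /=; have [A [B [-> -> _ _]]] := add_row_cat Q k.
  by exists [:: k]; rewrite // mem_cat mem_head orbT.
move=> c0; case: H => [c00|cQ]; first by rewrite c00 in c0.
have [A [r [B [_ sz ->]]]] := record_cell_row k c0 cQ.
exists (rcons r k); first by rewrite mem_cat mem_head orbT.
by rewrite size_rcons nth_rcons sz ltnn eqxx.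
Qed.

Lemma recorded_mono Q k c k' c' : c = 0 \/ c \in shape Q -> recorded Q k' c' ->
  recorded (record_cell Q k c) k' c'.
Proof.
move=> H [t tQ [lt_c ek]]; have [->|] := posnP c.
  rewrite /record_cell /=; have [A [B [eQ -> _ _]]] := add_row_cat Q k.
  exists t => //; move: tQ; rewrite {1}eQ !mem_cat inE => /orP[]->;
    rewrite ?orbT //.
move=> c0; case: H => [c00|cQ]; first by rewrite c00 in c0.
have [A [r [B [eQ sz ->]]]] := record_cell_row k c0 cQ.
move: tQ; rewrite eQ mem_cat inE orbCA => /orP[/eqP et|tAB].
  exists (rcons r k); first by rewrite mem_cat mem_head orbT.
  by rewrite -et size_rcons nth_rcons lt_c ltnS ltnW.
by exists t => //; rewrite mem_cat inE orbCA tAB orbT.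
Qed.

Lemma recorded_cols_mono Q k cs k' c' : recordable Q k cs -> recorded Q k' c' ->
  recorded (record_cols Q k cs) k' c'.
Proof.
elim: cs Q k => //= c cs IH Q k [H /IH{}IH] rec; apply: IH; exact: recorded_mono.
Qed.

Lemma recorded_cols Q k cs i : recordable Q k cs -> i < size cs ->
  recorded (record_cols Q k cs) (k + i) (nth 0 cs i).
Proof.
elim: cs Q k i => //= c cs IH Q k [|i] [H rec] lt_i /=.
  by rewrite addn0; apply: recorded_cols_mono rec _; exact: recorded_cell.
by rewrite addnS -addSn; exact: IH.
Qed.

Lemma recorded_inj Q k c c' : uniq (flatten Q) -> recorded Q k c -> recorded Q
  k c' ->
  c = c'.
Proof.
move=> uQ [r rQ [lt_c ek]] [r' r'Q [lt_c' ek']].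
have kr : k \in r by rewrite -ek mem_nth.
have kr' : k \in r' by rewrite -ek' mem_nth.
have [err ur] : r = r' /\ uniq r.
  elim: Q uQ rQ r'Q => //= t Q IH; rewrite cat_uniq !inE => /and3P[ut dis uQ].
  have notin u : u \in Q -> k \in u -> k \in t -> False.
    by move=> uQ' ku kt; case/hasP: dis; exists k => //; apply/flattenP; exists u.
  case/orP=> [/eqP er|rQ] /orP[/eqP er'|r'Q].
  - by rewrite er er'.
  - by case: (notin r' r'Q kr'); rewrite -er.
  - by case: (notin r rQ kr); rewrite -er'.
  - exact: IH.
by apply/eqP; rewrite -(nth_uniq 0 lt_c _ ur) ?err // -{1}err ek ek'.
Qed.

(** The shapes of [P] and [Q] stay equal up to order, so whenever a row of length [c] is extended in
    [P], one is available in [Q]. *)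
Lemma recordable_new_cols P Q k w : perm_eq (shape P) (shape Q) ->
  recordable Q k (new_cols P w).
Proof.
elim: w P Q k => //= x w IH P Q k pPQ.
case E: (insert x P) => [P' c] /=; have [A [B]] := insert_shape E.
have [->|c0] := posnP c => -[eP eP'].
  split; first by left.
  apply: IH; rewrite /record_cell /=; have [A' [B' [eQ -> _ _]]] := add_row_cat Q k.
  move: pPQ; rewrite eP eP' eQ /shape !map_cat /= => /seq.permP pPQ.
  by apply/seq.permP => p; have := pPQ p; rewrite !count_cat /=; lia.
have cQ : c \in shape Q by rewrite -(perm_mem pPQ) eP mem_cat mem_head orbT.
split; first by right.
apply: IH; have [A' [r [B' [eQ sz ->]]]] := record_cell_row k c0 cQ.
move: pPQ; rewrite eP eP' eQ /shape !map_cat /= size_rcons sz => /seq.permP pPQ.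
by apply/seq.permP => p; have := pPQ p; rewrite !count_cat /=; lia.
Qed.

Lemma record_cell_last Q k j : 0 < j ->
  record_cell (rcons Q (iota k j)) (k + j) j = rcons Q (iota k j.+1).
Proof.
move=> j0; rewrite /record_cell gtn_eqF // size_rcons.
have -> : iota 0 (size Q).+1 = rcons (iota 0 (size Q)) (size Q).
  by rewrite -cats1 -addn1 iotaD.
have frowE : frow (rcons Q (iota k j)) (size Q) = iota k j.
  by rewrite -cats1 frow_cat_cons.
rewrite filter_rcons frowE size_iota eqxx last_rcons /set_entry frowE.
rewrite -[X in set_nth 0 _ X](size_iota k j) set_nth_size -cats1
  set_nth_cat_cons cats1.
have -> : iota k j.+1 = iota k j ++ [:: k + j] by rewrite -[j.+1]addn1 iotaD.
by rewrite cats1.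
Qed.

Lemma record_row_tail Q k j i cs : 0 < j ->
  record_cols (rcons Q (iota k j)) (k + j) (iota j i ++ cs) =
    record_cols (rcons Q (iota k (j + i))) (k + (j + i)) cs /\
  (recordable (rcons Q (iota k (j + i))) (k + (j + i)) cs ->
   recordable (rcons Q (iota k j)) (k + j) (iota j i ++ cs)).
Proof.
elim: i j => [|i IH] j j0 /=; first by rewrite addn0.
rewrite record_cell_last //; have := IH j.+1 isT;
  rewrite addSnnS (addnS k j) => -[-> rec].
split=> // H; split; last exact: rec.
by right; rewrite /shape map_rcons mem_rcons size_iota mem_head.
Qed.

Lemma record_block_cols Q k a : all (leq 1) a -> all (fun r => head 0 r <= k) Q ->
  record_cols Q k (block_cols a) = Q ++ reshape a (iota k (sumn a)) /\
  recordable Q k (block_cols a).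
Proof.
elim: a Q k => [|m a IH] Q k /=; first by rewrite cats0.
move=> /andP[m0 apos] hQ.
rewrite /block_cols /= -/(block_cols a); case: m m0 => // m _.
(* No head in [Q] exceeds [k], so the new row goes on top. *)
rewrite /=; have -> : record_cell Q k 0 = rcons Q (iota k 1).
  rewrite /record_cell /= /add_row (_ : find _ _ = size Q) ?take_size
    ?drop_size ?cats1 //.
  apply/eqP; rewrite eqn_leq find_size leqNgt -has_find -all_predC.
  by apply: sub_all hQ => r /=; rewrite -leqNgt.
have := @record_row_tail Q k 1 m (block_cols a) isT;
  rewrite !add1n addn1 => -[-> rec].
have hQ' : all (fun r => head 0 r <= k + m.+1) (rcons Q (iota k m.+1)).
  rewrite all_rcons /= leq_addr; apply: sub_all hQ => r /leq_trans; apply.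
  exact: leq_addr.
have [-> recT] := IH _ _ apos hQ'.
split; last by split; [left|exact: rec].
by rewrite cat_rcons iotaD take_size_cat ?drop_size_cat ?size_iota // addSnnS.
Qed.

(** The columns of [block_cols a] do produce the canonical filling, and by [recorded_inj] no other
    sequence of columns can. *)
Lemma canonical_filling_cols w a : all (leq 1) a -> size w = sumn a ->
  record_cols [::] 1 (new_cols [::] w) = canonical_filling a <->
  new_cols [::] w = block_cols a.
Proof.
move=> apos szw; have [Qa reca] := @record_block_cols [::] 1 a apos isT.
rewrite /canonical_filling; split=> [eQ|->]; last exact: Qa.
have szb : size (block_cols a) = sumn a.
  rewrite size_flatten /shape -map_comp (eq_map (g := id)) ?map_id // => m.
  exact: size_iota.
apply: (@eq_from_nth _ 0); first by rewrite size_new_cols szb.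
move=> i lt_i; have lt_ib : i < size (block_cols a).
  by rewrite szb -szw -(size_new_cols [::]).
have r1 := recorded_cols (recordable_new_cols 1 w (perm_refl (shape [::]))) lt_i.
have r2 := recorded_cols reca lt_ib.
rewrite eQ in r1; rewrite Qa /= in r2; apply: recorded_inj r1 r2.
by rewrite reshapeKr ?iota_uniq // size_iota.
Qed.

(** * Permutations as words, and shuffles *)

Lemma one_line_perm n (s : 'S_n) : perm_eq (one_line s) (iota 1 n).
Proof.
apply: uniq_perm; rewrite ?iota_uniq //.
  by rewrite map_inj_uniq ?enum_uniq // => i j [/val_inj/perm_inj].
move=> x; rewrite mem_iota add1n ltnS; apply/mapP/andP => [[i _ ->]|[x0 le_x]].
  by rewrite ltn_ord.
have lt_x : x.-1 < n by rewrite prednK.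
exists ((s^-1)%g (Ordinal lt_x)); first exact: mem_enum.
by rewrite permKV /= prednK.
Qed.

Lemma one_line_exists n w : perm_eq w (iota 1 n) -> exists s : 'S_n, w = one_line s.
Proof.
move=> pw; have szw : size w = n by rewrite (perm_size pw) size_iota.
have uw : uniq w by rewrite (perm_uniq pw) iota_uniq.
have bnd i : i < n -> 0 < nth 0 w i <= n.
  move=> lt_i; have : nth 0 w i \in iota 1 n by rewrite -(perm_mem pw) mem_nth ?szw.
  by rewrite mem_iota add1n ltnS.
have lt_f (i : 'I_n) : (nth 0 w i).-1 < n by have := bnd i (ltn_ord i); lia.
pose f (i : 'I_n) : 'I_n := Ordinal (lt_f i).
have inj_f : injective f.
  move=> i j [e]; have /andP[bi _] := bnd i (ltn_ord i).
  have /andP[bj _] := bnd j (ltn_ord j); apply/val_inj/eqP.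
  by rewrite -(nth_uniq 0 _ _ uw) ?szw ?ltn_ord //= -(prednK bi) -(prednK bj) e.
exists (perm inj_f); apply: (@eq_from_nth _ 0).
  by rewrite size_map size_enum_ord.
move=> i; rewrite szw => lt_i.
rewrite (nth_map (Ordinal lt_i)) ?size_enum_ord // permE /= nth_enum_ord //.
by have := bnd i lt_i; lia.
Qed.

Lemma one_line_rev n (s : 'S_n) : one_line (w0 n * s)%g = rev (one_line s).
Proof.
apply: (@eq_from_nth _ 0); first by rewrite size_rev !size_map.
move=> i; rewrite size_map size_enum_ord => lt_i.
have lt_r : n - i.+1 < n by lia.
have nthE (t : 'S_n) j (lt_j : j < n) : nth 0 (one_line t) j = (t (Ordinal
  lt_j)).+1.
  rewrite (nth_map (Ordinal lt_j)) ?size_enum_ord //; congr (_ (t _)).+1.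
  by apply: val_inj; exact: nth_enum_ord.
rewrite nth_rev size_map size_enum_ord // (nthE _ _ lt_i) (nthE _ _ lt_r) permM.
by congr (_ (s _)).+1; apply: val_inj; rewrite /w0 permE.
Qed.

Lemma w_r_rev T : w_r T = rev (flatten (rev T)).
Proof. by rewrite /w_r rev_flatten map_rev revK. Qed.

Lemma good_shape_shuffle a : all (leq 1) a -> shuffle_of_partition_and_ones a ->
  good_shape a.
Proof.
move=> apos [l [k [/andP[_ sl] [m [szm mT mF]]]]].
elim: a l k m apos sl szm mT mF => // x a IH l k [|b m] //= /andP[x0 apos] sl
  [szm] mT mF.
have in_mask y : y \in a -> y \in mask m a \/ y \in mask (map negb m) a.
  elim: m a szm {IH apos mT mF} => [|c m IHm] [|z a] //= [szm].
  rewrite inE => /orP[/eqP ->|ya]; first by case: c; rewrite mem_head; [left|right].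
  by case: (IHm a szm ya) => H; case: c; rewrite ?inE ?H ?orbT;
    [left|left|right|right].
case: b mT mF => /= mT mF.
  rewrite -mT /= in sl; apply/andP; split;
    last exact: (IH _ k m apos (path_sorted sl) szm erefl mF).
  (* A later entry is either a later part of the partition or one of the ones. *)
  apply/orP; right; apply/allP => y /in_mask[yl|yo].
    have /allP H := order_path_min (rev_trans leq_trans) sl; exact: H.
  by move: yo; rewrite mF => /nseqP[-> _].
case: k mF => // k [x1 mF]; rewrite /dominates x1 /=.
exact: (IH l k m).
Qed.

Theorem theorem5p8 (n : nat) (a : seq nat) :
  is_composition n a ->
  shuffle_of_partition_and_ones a ->
  forall w : seq nat,
    (exists2 s : 'S_n, s \in K_set n a & w = one_line s)
    <-> (exists2 T : filling, SETsed a T & w = w_r T).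
Proof.
move=> /andP[apos /eqP suma] shuf w.
have gooda := good_shape_shuffle apos shuf.
(* [flatten (rev T)] is the reversal of [w_r T], that is, the word to be inserted. *)
have core T : shape T = a -> perm_eq (flatten T) (iota 1 n) ->
    (shape (PQ_word (flatten (rev T))).1 = a /\
     (PQ_word (flatten (rev T))).2 = canonical_filling (rev a)) <->
    [/\ all (sorted ltn) T, columns_increase T & SE_decreasing a T].
  move=> shT pT; rewrite /PQ_word PQ_word_cols /= insert_rows_word.
  have szw : size (flatten (rev T)) = sumn (rev a).
    by rewrite size_flatten /shape map_rev !sumn_rev -shT.
  have posT : all (leq 1) (shape T) by rewrite shT.
  have goodT : good_shape (shape T) by rewrite shT.
  rewrite (canonical_filling_cols _ szw) ?all_rev // -shT row_cols_word
    -stack_tableauP.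
  split=> [[shP rcT]|stk]; last by have [] := insert_rows_spec posT goodT stk.
  by apply: stack_tableau_of_insert; rewrite // (perm_uniq pT) iota_uniq.
split=> [[s sK ew]|[T [[shT pT sT cT] seT] ew]].
  have pw : perm_eq w (iota 1 n) by rewrite ew one_line_perm.
  have szw : sumn (rev a) = size (rev w).
    by rewrite sumn_rev suma size_rev (perm_size pw) size_iota.
  (* The reversed word is cut into the rows of [T], from top to bottom. *)
  pose T := rev (reshape (rev a) (rev w)).
  have shT : shape T = a.
    by rewrite /T /shape map_rev -[map _ _]/(shape _) reshapeKl ?revK // szw.
  have fT : flatten (rev T) = rev w by rewrite revK reshapeKr // szw.
  have ewT : w = w_r T by rewrite w_r_rev fT revK.
  have pT : perm_eq (flatten T) (iota 1 n).
    apply: perm_trans pw; rewrite ewT w_r_rev perm_sym perm_rev.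
    by apply: perm_flatten; rewrite perm_rev.
  move: sK; rewrite inE /P_hat /Q_hat one_line_rev -ew -fT => /andP[/eqP shP
    /eqP eQ].
  have [] := (core T shT pT).1 (conj shP eQ) => sT cT seT.
  by exists T => //; split=> //; split=> //; rewrite suma.
rewrite suma in pT; have pw : perm_eq w (iota 1 n).
  apply: perm_trans pT; rewrite ew w_r_rev perm_rev.
  by apply: perm_flatten; rewrite perm_rev.
have [s es] := one_line_exists pw; exists s => //.
have [shP eQ] := (core T shT pT).2 (And3 sT cT seT).
rewrite inE /P_hat /Q_hat one_line_rev -es ew w_r_rev revK.
by rewrite shP eQ !eqxx.
Qed.
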